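(* Consider percolation on $\mathbb Z^d$, $d\ge2$, with finitely many vertex weights and parameter $\beta>0$, as defined in the context. For $\beta>0$ let $\theta_n(\beta)=\mathbb P(0\leftrightarrow\partial\Lambda_n)$ and $\theta(\beta)=\mathbb P(0\leftrightarrow\infty)$ in the model with parameter $\beta$. Assume that there exists $\beta_c\in\,]0,\infty[$ such that $\theta(\beta)=0$ for all $\beta\in\,]0,\beta_c[$ and $\theta(\beta)>0$ for all $\beta\in\,]\beta_c,+\infty[$. Then: (a) for every $\beta\in\,]0,\beta_c[$ there exists $c_\beta>0$ such that for all $n$ large enough, $\theta_n(\beta)\le\exp(-c_\beta n)$; (b) there exist $c,\delta>0$ such that $\theta(\beta)\ge c\,(\beta-\beta_c)$ for all $\beta\in[\beta_c,\beta_c+\delta[$.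
   Context: Model. $\mathbb Z^d$ has edge set $E=\{\{x,y\}\subset\mathbb Z^d:\|x-y\|_1=1\}$. Let $M,N\ge1$ be integers; $\llbracket a,b\rrbracket$ denotes the set of integers from $a$ to $b$. Let $h:\llbracket 0,M\rrbracket\times\,]0,\infty[\,\to[0,1[$, $(m,\beta)\mapsto h_m(\beta)$, and $\zeta:\llbracket0,N\rrbracket^2\to\llbracket0,M\rrbracket$ satisfy: - $\zeta(n_1,n_2)=\zeta(n_2,n_1)$ for all $n_1,n_2$; - $\zeta$ is nondecreasing for the product order; - $0=h_0<h_1<\dots<h_M$ pointwise, and for all $m\in\llbracket1,M\rrbracket$ the function $h_m$ is increasing and of class $C^1$ in $\beta$; - for all $m\in\llbracket1,M\rrbracket$, $h_m'>\frac{1-h_m}{1-h_{m-1}}\,h_{m-1}'$ (pointwise in $\beta$). Let $q_\nu$ be a probability distribution on $\llbracket0,N\rrbracket$ with $q_\nu(N)>0$. Let $(\nu_x)_{x\in\mathbb Z^d}$ be i.i.d. with law $q_\nu$ and, independently, $(U_e)_{e\in E}$ i.i.d. uniform on $[0,1]$. In the model with parameter $\beta>0$, the edge $e=\{x,y\}$ is open if $h_{\zeta(\nu_x,\nu_y)}(\beta)\ge U_e$. Notation: $\partial\Lambda_n=\{x\in\mathbb Z^d:\|x\|_\infty=n\}$; $0\leftrightarrow\partial\Lambda_n$ means that there is a path of open edges from $0$ to some vertex of $\partial\Lambda_n$; $0\leftrightarrow\infty$ means that $0$ is connected by paths of open edges to vertices arbitrarily far away. $]a,b[$ and $[a,b[$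 denote open and half-open intervals. *)

(* Defs.v *)
From HB Require Import structures.
From mathcomp Require Import all_boot all_order all_algebra.
From mathcomp Require Import finmap.
From mathcomp Require Import all_classical all_reals all_analysis.
Import Order.TTheory GRing.Theory Num.Theory numFieldNormedType.Exports.

Set Implicit Arguments.
Unset Strict Implicit.
Unset Printing Implicit Defensive.

Local Open Scope classical_set_scope.
Local Open Scope ring_scope.

HB.instance Definition _ (n : nat) := isPointed.Build 'I_n.+1 ord0.

(* Vertex weights live in 'I_N.+1 with every subset measurable. *)
HB.instance Definition _ (n : nat) := @isMeasurable.Build default_measure_display
  'I_n.+1 discrete_measurable discrete_measurable0
  discrete_measurableC discrete_measurableU.

Section random_families.
Context {dT dS : measure_display} {T : measurableType dT} {S : measurableType dS}
  {R : realType} (P : probability T R).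

(* The equality is required on measurable sets only: outside of them neither
   side is meaningful. *)
Definition has_law (X : {RV P >-> S}) (mu : probability S R) : Prop :=
  forall A : set S, measurable A -> distribution P X A = mu A.

Definition mutually_independent (J : choiceType) (I : set J)
    (X : J -> {RV P >-> S}) : Prop :=
  forall (F : {fset J}) (A : J -> set S),
    [set` F] `<=` I -> (forall j, measurable (A j)) ->
    P (\bigcap_(j in [set` F]) (X j @^-1` A j)) =
    (\prod_(j <- F) P (X j @^-1` A j))%E.

Definition iid (J : choiceType) (I : set J)
    (X : J -> {RV P >-> S}) (mu : probability S R) : Prop :=
  mutually_independent I X /\ forall j, I j -> has_law (X j) mu.

Definition generated_sigma_algebra (J : Type) (I : set J)
    (X : J -> {RV P >-> S}) : set (set T) :=
  <<s \bigcup_(j in I) preimage_set_system setT (X j) measurable >>.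

End random_families.

Definition independent_systems {dT : measure_display} {T : measurableType dT}
    {R : realType} (P : probability T R) (F G : set (set T)) : Prop :=
  forall A B : set T, F A -> G B -> P (A `&` B) = (P A * P B)%E.

Section percolation.
Context {d : nat}.
Notation V := 'rV[int]_d.

Definition l1norm (x : V) : nat := (\sum_(i < d) `|x ord0 i|)%N.
Definition linfnorm (x : V) : nat := (\max_(i < d) `|x ord0 i|)%N.

Definition boundary_box (n : nat) : set V := [set x | linfnorm x = n].

(* Unoriented edges are the two-element sets {x, y} themselves. *)
Definition edges : set (set V) :=
  [set e | exists x y : V, l1norm (x - y) = 1%N /\ e = [set x; y]].

Definition connected_by (r : rel V) (x y : V) : Prop :=
  exists2 p : seq V, path r x p & last x p = y.

Context {dT : measure_display} {T : measurableType dT} {R : realType}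
  (P : probability T R) {M N : nat} (h : 'I_M.+1 -> R -> R)
  (zeta : 'I_N.+1 -> 'I_N.+1 -> 'I_M.+1)
  (nu : V -> {RV P >-> 'I_N.+1})
  (U : set V -> {RV P >-> measurableTypeR R}).

Definition open_edge (beta : R) (w : T) : rel V :=
  [rel x y | (l1norm (x - y) == 1%N) &&
             (U [set x; y] w <= h (zeta (nu x w) (nu y w)) beta)].

Definition theta_n (n : nat) (beta : R) : \bar R :=
  P [set w | exists2 y, boundary_box n y &
                        connected_by (open_edge beta w) 0 y].

Definition theta (beta : R) : \bar R :=
  P [set w | forall n : nat, exists2 y, (n <= linfnorm y)%N &
                             connected_by (open_edge beta w) 0 y].

End percolation.

(* Main.v *)
(** This is the argument of Duminil-Copin and Tassion, adapted to vertex weights;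
constants are irrelevant in its dichotomy. For a finite set S containing 0, let
phi(S) be the sum over the inner boundary vertices x of S of P(0 <-> x in S).

If phi(S) is small for some S, condition on the cluster of 0 in S: the event
that the cluster is C decreases in the weights off C, whereas a connection off C
from a neighbour of S to distance n increases in them, so by Harris' inequality
theta_(n+L) <= theta_n / 2.

If phi(S) is bounded below for all S, let S be the set of vertices that are not
connected to the boundary of the box. Conditioning on S biases the weights near
its boundary, but not the configuration in its interior S'. A connection from 0
to the inner boundary of S' in S' is turned into a closed pivotal edge of S by
a modification of boundedly many coordinates, which gives three vertices the
maximal weight N. Russo's formula then gives theta_n' >= c (1 - theta_n), hence
linear growth of theta.

To make the model a product of finite chains, the variable U_e is replaced by its
level, the number of indices m with h_m < U_e: the edge {x, y} is then open if and
only if its level is at most zeta(nu_x, nu_y). *)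

Require Import Defs.
From mathcomp Require Import all_boot all_order all_algebra.
From mathcomp Require Import finmap.
From mathcomp Require Import all_classical all_reals all_analysis.
From mathcomp Require Import ring lra zify.
Import Order.TTheory GRing.Theory Num.Theory numFieldNormedType.Exports.

Set Implicit Arguments.
Unset Strict Implicit.
Unset Printing Implicit Defensive.

Local Open Scope ring_scope.

(** * Expectations under product measures *)

(** An edge reads the weights at both ends. If these are low its index may be 0, and since h_0 = 0
    such an edge is almost surely closed and contributes nothing to Russo's formula. Setting the
    weights at the ends of the cut edge to N gives it the index zeta(N, N) >= 1, but may open other
    edges across the boundary of S at these ends; they are closed at the same time. The cost is a
    product of powers of q_nu(N), h_1 and 1 - h_M, with exponents that do not depend on n.

    For fixed weights, the derivative in beta of the probability that a level is at most j is h_j',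
    and the inequality assumed between successive derivatives makes h_j' positive for j >= 1.

    The two halves of the dichotomy meet at beta_c because phi(S) is nondecreasing in beta. If phi
    is bounded below at some beta < beta_c, it stays so above beta, and linear growth of theta from
    beta contradicts theta = 0 on ]beta, beta_c[. Above beta_c, no phi(S) can be small, since
    theta_n would tend to 0. *)

Section ProductExpectation.
Variables (R : realFieldType) (I K : finType).
Implicit Types (f g : {ffun I -> K}) (X Y : {ffun I -> K} -> R).
Implicit Types (m : I -> K -> R) (a : K -> R).

Definition upd f i k : {ffun I -> K} := [ffun j => if j == i then k else f j].

Lemma updE f i k j : upd f i k j = if j == i then k else f j.
Proof. by rewrite ffunE. Qed.

Lemma upd_same f i k l : upd (upd f i k) i l = upd f i l.
Proof. by apply/ffunP => j; rewrite !updE; case: eqP. Qed.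

Lemma updC f i j k l : i != j -> upd (upd f i k) j l = upd (upd f j l) i k.
Proof.
by move=> ij; apply/ffunP => t; rewrite !updE; case: (eqVneq t j) => // ->;
  rewrite eq_sym (negbTE ij).
Qed.

Lemma upd_id f i : upd f i (f i) = f.
Proof. by apply/ffunP => j; rewrite updE; case: eqP => // ->. Qed.

Definition Ex m X : R := \sum_(f : {ffun I -> K}) (\prod_i m i (f i)) * X f.

(** [a] need not be a probability: when [a] is the derivative of a law, this average is a term of
    Russo's formula. *)
Definition avg a i X f : R := \sum_k a k * X (upd f i k).

Definition incr_in (leK : rel K) i X :=
  forall f k k', leK k k' -> X (upd f i k) <= X (upd f i k').
Definition indep_of i X := forall f k, X (upd f i k) = X f.

(** A spare value [k] of weight [m i k] is added and exchanged with [f i]; the exchange is an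
    involution of the pairs. This is how a product with one factor replaced becomes an expectation
    under the original product. *)
Lemma Ex_resample m i a X : \sum_k m i k = 1 ->
  \sum_(f : {ffun I -> K}) (a (f i) * \prod_(j | j != i) m j (f j)) * X f = Ex m (avg a i X).
Proof.
move=> m1.
pose W f := \prod_(j | j != i) m j (f j).
have WE f k : W (upd f i k) = W f.
  by apply: eq_bigr => j ji; rewrite updE (negbTE ji).
transitivity (\sum_(p : {ffun I -> K} * K) m i p.2 * a (p.1 i) * W p.1 * X p.1).
  rewrite -(pair_bigA _ (fun f k => m i k * a (f i) * W f * X f)) /=.
  apply: eq_bigr => f _; rewrite -/(W f) -[LHS]mul1r -m1 mulr_suml.
  by apply: eq_bigr => k _; rewrite !mulrA.
rewrite (reindex (fun p : {ffun I -> K} * K => (upd p.1 i p.2, p.1 i))) /=; last first.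
  exists (fun p : {ffun I -> K} * K => (upd p.1 i p.2, p.1 i)) => -[f k] _ /=;
    by rewrite upd_same upd_id updE eqxx.
rewrite -(pair_bigA _ (fun f k => m i (f i) * a (upd f i k i) * W (upd f i k)
   * X (upd f i k))) /=.
apply: eq_bigr => f _; rewrite /avg mulr_sumr; apply: eq_bigr => k _.
rewrite updE eqxx WE [in RHS](bigD1 i) //=; rewrite -/(W f); ring.
Qed.

Lemma Ex_avg m i X : \sum_k m i k = 1 -> Ex m (avg (m i) i X) = Ex m X.
Proof.
by move=> m1; rewrite -Ex_resample //; apply: eq_bigr => f _; rewrite [in RHS](bigD1 i).
Qed.

Lemma Ex1 m : (forall i, \sum_k m i k = 1) -> Ex m (fun=> 1) = 1.
Proof.
move=> m1; rewrite /Ex; under eq_bigr do rewrite mulr1.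
by rewrite -(bigA_distr_bigA (fun i k => m i k)) big1.
Qed.

Lemma Ex_cst m c : (forall i, \sum_k m i k = 1) -> Ex m (fun=> c) = c.
Proof.
by move=> m1; rewrite /Ex -mulr_suml -[RHS]mul1r -[in RHS](Ex1 m1) /Ex;
  congr (_ * _); apply: eq_bigr => f _; rewrite mulr1.
Qed.

Lemma eq_Ex m X Y : (forall f, X f = Y f) -> Ex m X = Ex m Y.
Proof. by move=> XY; apply: eq_bigr => f _; rewrite XY. Qed.

Lemma Ex_le m X Y : (forall i k, 0 <= m i k) -> (forall f, X f <= Y f) ->
  Ex m X <= Ex m Y.
Proof.
by move=> m0 XY; apply: ler_sum => f _; apply: ler_wpM2l => //; apply: prodr_ge0.
Qed.

Lemma Ex_sum m (J : Type) (r : seq J) (Q : pred J) (F : J -> {ffun I -> K} -> R) :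
  Ex m (fun f => \sum_(j <- r | Q j) F j f) = \sum_(j <- r | Q j) Ex m (F j).
Proof.
by rewrite exchange_big /=; apply: eq_bigr => f _; rewrite mulr_sumr.
Qed.

Lemma ExD m X Y : Ex m (fun f => X f + Y f) = Ex m X + Ex m Y.
Proof. by rewrite -big_split; apply: eq_bigr => f _; rewrite mulrDr. Qed.

Lemma Ex_scale m c X : Ex m (fun f => c * X f) = c * Ex m X.
Proof. by rewrite mulr_sumr; apply: eq_bigr => f _; rewrite mulrCA. Qed.

Lemma Ex_coord m i k : (forall i, \sum_k m i k = 1) ->
  Ex m (fun f => (f i == k)%:R) = m i k.
Proof.
move=> m1; rewrite -(Ex_avg _ (m1 i)) -[RHS](Ex_cst _ m1); apply: eq_Ex => f.
rewrite /avg (bigD1 k) //= updE !eqxx mulr1 big1 ?addr0 // => l /negbTE lk.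
by rewrite updE eqxx lk mulr0.
Qed.

Lemma Ex_upd_le m i k X : (forall i k, 0 <= m i k) -> \sum_k m i k = 1 ->
  (forall f, 0 <= X f) -> m i k * Ex m (fun f => X (upd f i k)) <= Ex m X.
Proof.
move=> m0 m1 X0; rewrite -(Ex_avg X m1) -Ex_scale; apply: Ex_le => // f.
rewrite /avg (bigD1 k) //= lerDl; apply: sumr_ge0 => l _; exact: mulr_ge0.
Qed.

Lemma indep_of_all X : (forall i, indep_of i X) -> forall f g, X f = X g.
Proof.
move=> iX f g.
suff H (s : seq I) : X f = X [ffun i => if i \in s then g i else f i].
  rewrite (H (enum I)); congr X; apply/ffunP => i.
  by rewrite ffunE mem_enum.
elim: s => [|i s ->]; first by congr X; apply/ffunP => i; rewrite ffunE.
rewrite -(iX i _ (g i)); congr X; apply/ffunP => j; rewrite !ffunE in_cons.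
by case: eqP => // ->.
Qed.

Lemma avg_indep_same a i X : indep_of i (avg a i X).
Proof. by move=> f k; apply: eq_bigr => l _; rewrite upd_same. Qed.

Lemma avg_indep a j i X : indep_of i X -> indep_of i (avg a j X).
Proof.
have [->|ij] := eqVneq i j; first by move=> _; exact: avg_indep_same.
by move=> iX f k; apply: eq_bigr => l _; rewrite updC // iX.
Qed.

Lemma avg_incr (leK : rel K) a j i X : (forall k, 0 <= a k) ->
  incr_in leK i X -> incr_in leK i (avg a j X).
Proof.
move=> a0; have [->|ij] := eqVneq i j.
  by move=> _ f k k' _; rewrite !avg_indep_same.
move=> iX f k k' kk'; apply: ler_sum => l _; apply: ler_wpM2l => //.
by rewrite !(updC _ _ _ ij); exact: iX.
Qed.

Lemma avg_le a i X Y : (forall k, 0 <= a k) -> (forall f, X f <= Y f) ->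
  forall f, avg a i X f <= avg a i Y f.
Proof. by move=> a0 XY f; apply: ler_sum => l _; apply: ler_wpM2l. Qed.

(** Symmetrisation: the double sum of (x k - x l) (y k - y l) has nonpositive terms and equals twice
    the difference of the two sides. *)
Lemma chebyshev_sum (leK : rel K) a (x y : K -> R) : total leK ->
  (forall k, 0 <= a k) -> \sum_k a k = 1 ->
  (forall k l, leK k l -> x k <= x l) -> (forall k l, leK k l -> y l <= y k) ->
  \sum_k a k * (x k * y k) <= (\sum_k a k * x k) * (\sum_k a k * y k).
Proof.
move=> tot a0 a1 xi yd.
have : \sum_k \sum_l a k * a l * ((x k - x l) * (y k - y l)) <= 0.
  apply: sumr_le0 => k _; apply: sumr_le0 => l _.
  apply: mulr_ge0_le0; first exact: mulr_ge0.
  have /orP[kl|lk] := tot k l.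
    by apply: mulr_le0_ge0; rewrite ?subr_le0 ?subr_ge0 ?xi ?yd.
  by apply: mulr_ge0_le0; rewrite ?subr_le0 ?subr_ge0 ?xi ?yd.
set A := \sum_k a k * (x k * y k).
set B := (X in X * _); set C := (X in _ * X).
suff -> : \sum_k \sum_l a k * a l * ((x k - x l) * (y k - y l)) = 2 * (A - B * C) by lra.
transitivity (\sum_k \sum_l (a k * (x k * y k) * a l + a k * (a l * (x l * y l))
   - a k * x k * (a l * y l) - a k * y k * (a l * x l))).
  by apply: eq_bigr => k _; apply: eq_bigr => l _; ring.
under eq_bigr => k _ do rewrite !(big_split, sumrN) /= -!mulr_sumr a1 -/A -/B -/C.
rewrite !(big_split, sumrN) /= -!mulr_suml a1 -/A -/B -/C; ring.
Qed.

(** * Harris' inequality and independence *)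

Section Harris.
Variables (leK : rel K) (totK : total leK) (m : I -> K -> R).
Hypotheses (m_ge0 : forall i k, 0 <= m i k) (m_sum1 : forall i, \sum_k m i k = 1).

(** A condition on one coordinate, stable under averaging over any other; the alternative may change
    from coordinate to coordinate. *)
Definition neg_corr_in i X Y :=
  [\/ incr_in leK i X /\ incr_in (fun k l => leK l k) i Y, indep_of i X | indep_of i Y].

Lemma avg_neg_corr i X Y f : neg_corr_in i X Y ->
  avg (m i) i (fun g => X g * Y g) f <= avg (m i) i X f * avg (m i) i Y f.
Proof.
case=> [[iX dY]|iX|iY].
- apply: (chebyshev_sum (x := fun k => X (upd f i k)) (y := fun k => Y (upd f i k)))
    => // k l kl; [exact: iX | exact: dY].
- rewrite /avg [X in _ <= X * _](_ : _ = X f); last first.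
    by under eq_bigr do rewrite iX; rewrite -mulr_suml m_sum1 mul1r.
  by rewrite mulr_sumr; apply: ler_sum => k _; rewrite iX mulrCA.
- rewrite /avg [X in _ <= _ * X](_ : _ = Y f); last first.
    by under eq_bigr do rewrite iY; rewrite -mulr_suml m_sum1 mul1r.
  by rewrite mulr_suml; apply: ler_sum => k _; rewrite iY mulrA.
Qed.

Lemma neg_corr_avg j i X Y : neg_corr_in i X Y ->
  neg_corr_in i (avg (m j) j X) (avg (m j) j Y).
Proof.
case=> [[iX dY]|iX|iY]; first by constructor 1; split; exact: avg_incr.
- by constructor 2; exact: avg_indep.
- by constructor 3; exact: avg_indep.
Qed.

(* Generalises both Harris' inequality and the independence of functions with
   disjoint supports. *)
Lemma Ex_neg_corr X Y : (forall i, neg_corr_in i X Y) ->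
  Ex m (fun f => X f * Y f) <= Ex m X * Ex m Y.
Proof.
move=> nc.
(* The coordinates in [s] are averaged out one at a time. The inequality survives each stage, and
   averaging over all of them leaves the constant [Ex m Z]. *)
pose avgs s Z := foldr (fun i (Z : {ffun I -> K} -> R) => avg (m i) i Z) Z s.
have ExA s Z : Ex m (avgs s Z) = Ex m Z.
  by elim: s => //= i s IH; rewrite Ex_avg.
have ncA s i : neg_corr_in i (avgs s X) (avgs s Y).
  by elim: s => [|j s IH] /=; [exact: nc | exact: neg_corr_avg].
have leA s f : avgs s (fun f => X f * Y f) f <= avgs s X f * avgs s Y f.
  elim: s f => //= i s IH f.
  exact: le_trans (avg_le i (m_ge0 i) IH f) (avg_neg_corr f (ncA s i)).
have indA s Z i : i \in s -> indep_of i (avgs s Z).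
  elim: s => // j s IH; rewrite in_cons => /predU1P[->|/IH iZ].
    exact: avg_indep_same.
  exact: avg_indep.
have cstA Z f : avgs (enum I) Z f = Ex m Z.
  rewrite -(ExA (enum I)) -[LHS](Ex_cst _ m_sum1); apply: eq_Ex => g.
  by apply: indep_of_all => i; apply: indA; rewrite mem_enum.
have -> : Ex m X * Ex m Y = Ex m (fun f => avgs (enum I) X f * avgs (enum I) Y f).
  by rewrite -[LHS](Ex_cst _ m_sum1); apply: eq_Ex => f; rewrite !cstA.
by rewrite -(ExA (enum I)); apply: Ex_le.
Qed.

(** Independence of one factor is unaffected by a change of sign, so the inequality applied to X and
    to - X gives both directions. *)
Lemma Ex_indep X Y : (forall i, indep_of i X \/ indep_of i Y) ->
  Ex m (fun f => X f * Y f) = Ex m X * Ex m Y.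
Proof.
move=> ind; apply/eqP; rewrite eq_le; apply/andP; split.
  by apply: Ex_neg_corr => i; case: (ind i); [constructor 2 | constructor 3].
suff : Ex m (fun f => - X f * Y f) <= Ex m (fun f => - X f) * Ex m Y.
  have EN Z : Ex m (fun f => - Z f) = - Ex m Z.
    by rewrite -mulN1r -Ex_scale; apply: eq_Ex => f; rewrite mulN1r.
  rewrite (eq_Ex _ (Y := fun f => - (X f * Y f))); last by move=> f; rewrite mulNr.
  by rewrite !EN mulNr lerN2.
apply: Ex_neg_corr => i; case: (ind i) => [iX|iY].
  by constructor 2 => f k; rewrite iX.
by constructor 3.
Qed.
End Harris.
End ProductExpectation.

(** * Percolation on a finite graph *)

Lemma ler_bool (R : numDomainType) (b c : bool) : (b -> c) -> b%:R <= c%:R :> R.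
Proof. by rewrite ler_nat; case: b => // ->. Qed.

Lemma ler_sum_term (R : realFieldType) (J : finType) (Q : pred J) (F : J -> R) j :
  Q j -> (forall i, Q i -> 0 <= F i) -> F j <= \sum_(i | Q i) F i.
Proof.
move=> Qj F0; rewrite (bigD1 j) //= lerDl; apply: sumr_ge0 => i /andP[+ _].
exact: F0.
Qed.

Definition leqI n : rel 'I_n := fun k l => (k <= l)%N.

Lemma leqI_total n : total (@leqI n).
Proof. by move=> k l; exact: leq_total. Qed.

(** For an event that sees a level only through a threshold, the derivative of the law enters only
    through the derivative of its distribution function at the threshold. *)
Lemma threshold_sum (R : pzRingType) M (j : 'I_M.+1) (w g : 'I_M.+2 -> R) :
  \sum_k w k = 0 -> (forall k k' : 'I_M.+2, (k <= j)%N = (k' <= j)%N -> g k = g k') ->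
  \sum_k w k * g k = (\sum_(k : 'I_M.+2 | (k <= j)%N) w k) * (g ord0 - g ord_max).
Proof.
move=> + gE; have jmax : ((@ord_max M.+1 : nat) <= j)%N = false.
  by apply/negbTE; rewrite -ltnNge.
rewrite (bigID (fun k : 'I_M.+2 => (k <= j)%N)) /= => /eqP.
rewrite addrC addr_eq0 => /eqP wE; rewrite (bigID (fun k : 'I_M.+2 => (k <= j)%N)) /=.
under eq_bigr => k kj do rewrite (gE k ord0) ?kj //.
rewrite -mulr_suml.
under [X in _ + X]eq_bigr => k kj do rewrite (gE k ord_max) ?(negbTE kj) ?jmax //.
by rewrite -mulr_suml wE mulNr mulrBr.
Qed.

Section FinitePercolation.
Variables (V : finType) (e : rel V) (N M : nat).
Variable zeta : 'I_N.+1 -> 'I_N.+1 -> 'I_M.+1.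
Hypothesis e_sym : symmetric e.
Hypothesis zeta_sym : forall n1 n2, zeta n1 n2 = zeta n2 n1.
Hypothesis zeta_mono : forall n1 n2 n1' n2' : 'I_N.+1, (n1 <= n1')%N -> (n2 <= n2')%N ->
    (zeta n1 n2 <= zeta n1' n2')%N.

Notation weights := {ffun V -> 'I_N.+1}.
Notation levels := {ffun {set V} -> 'I_M.+2}.
Implicit Types (v : weights) (u : levels) (A B C D S : {set V}) (x y z : V).

(** Levels run from 0 to M + 1, and M + 1 exceeds every value of [zeta]: the level [ord_max] closes
    an edge whatever the weights. *)
Definition opn v u : rel V :=
  fun x y => e x y && (u [set x; y]%SET <= zeta (v x) (v y))%N.

(** The empty path relates a vertex to itself even outside [A]. *)
Definition conn v u A : rel V :=
  connect [rel a b | [&& a \in A, b \in A & opn v u a b]].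

Definition hit v u B D y := [exists z in D, conn v u B y z].

Lemma opn_sym v u : symmetric (opn v u).
Proof. by move=> x y; rewrite /opn e_sym finset.setUC zeta_sym. Qed.

Lemma conn_sym v u A : symmetric (conn v u A).
Proof.
apply: sym_connect_sym => x y /=.
by rewrite opn_sym andbCA.
Qed.

Lemma conn_sub v u v' u' A B x y :
  {in A &, forall a b, opn v u a b -> [&& a \in B, b \in B & opn v' u' a b]} ->
  conn v u A x y -> conn v' u' B x y.
Proof.
move=> H; apply: connect_sub => a b /= /and3P[aA bA ab]; apply: connect1.
exact: H.
Qed.

Lemma conn_subset v u A B x y : A \subset B -> conn v u A x y -> conn v u B x y.
Proof.
by move=> /fintype.subsetP AB; apply: conn_sub => a b aA bA ->; rewrite !AB.
Qed.

Lemma eq_conn v u v' u' A x y :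
  {in A &, forall a b, opn v u a b = opn v' u' a b} -> conn v u A x y = conn v' u' A x y.
Proof.
by move=> H; apply/idP/idP; apply: conn_sub => a b aA bA; rewrite H // aA bA.
Qed.

Lemma conn_closed v u A C x y : x \in C ->
  {in A &, forall a b, a \in C -> opn v u a b -> b \in C} ->
  conn v u A x y -> y \in C.
Proof.
move=> xC clC; move=> /connectP[p + ->]; elim: p x xC => //= z p IH x xC.
by move=> /andP[/and3P[xA zA xz]]; apply: IH; exact: clC xz.
Qed.

Lemma conn_inside v u A C x y : x \in C ->
  {in A &, forall a b, a \in C -> opn v u a b -> b \in C} ->
  conn v u A x y -> conn v u C x y.
Proof.
move=> xC clC; move=> /connectP[p + ->]; elim: p x xC => [|z p IH] x xC /=.
  by move=> _; exact: connect0.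
move=> /andP[/and3P[xA zA xz] pth]; have zC := clC x z xA zA xC xz.
by apply: connect_trans (IH z zC pth); apply: connect1; rewrite /= xC zC.
Qed.

Lemma conn_mem v u A x y : x \in A -> conn v u A x y -> y \in A.
Proof. by move=> xA; apply: conn_closed. Qed.

Lemma conn1 v u A x y : x \in A -> y \in A -> opn v u x y -> conn v u A x y.
Proof. by move=> xA yA xy; apply: connect1; rewrite /= xA yA. Qed.

Lemma opn_mono v v' u u' x y : (v x <= v' x)%N -> (v y <= v' y)%N ->
  (u' [set x; y]%SET <= u [set x; y]%SET)%N -> opn v u x y -> opn v' u' x y.
Proof.
move=> vx vy us /andP[exy uz]; rewrite /opn exy /=.
exact: leq_trans us (leq_trans uz (zeta_mono vx vy)).
Qed.

Lemma opn_updl v u x k y z : y != x -> z != x -> opn (upd v x k) u y z = opn v u y z.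
Proof. by move=> yx zx; rewrite /opn !updE (negbTE yx) (negbTE zx). Qed.

Lemma opn_updr v u s k y z : [set y; z]%SET != s -> opn v (upd u s k) y z = opn v u y z.
Proof. by move=> yzs; rewrite /opn !updE (negbTE yzs). Qed.

Lemma opn_updl_mono v u x (k k' : 'I_N.+1) y z : (k <= k')%N ->
  opn (upd v x k) u y z -> opn (upd v x k') u y z.
Proof. by move=> kk'; apply: opn_mono => //; rewrite !updE; case: eqP. Qed.

Lemma opn_updr_mono v u s (k k' : 'I_M.+2) y z : (k' <= k)%N ->
  opn v (upd u s k) y z -> opn v (upd u s k') y z.
Proof. by move=> kk'; apply: opn_mono => //; rewrite !updE; case: eqP. Qed.

Lemma sub_hit v u v' u' A B D y :
  {in A &, forall a b, opn v u a b -> [&& a \in B, b \in B & opn v' u' a b]} ->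
  hit v u A D y -> hit v' u' B D y.
Proof.
by move=> H /exists_inP[z zD yz]; apply/exists_inP; exists z => //; apply: conn_sub yz.
Qed.

Lemma eq_hit v u v' u' A D y :
  {in A &, forall a b, opn v u a b = opn v' u' a b} -> hit v u A D y = hit v' u' A D y.
Proof. by move=> H; apply: eq_existsb => z; rewrite (eq_conn _ _ H). Qed.

Lemma hit_conn v u A D x y : conn v u A x y -> hit v u A D y -> hit v u A D x.
Proof.
move=> xy /exists_inP[z zD yz]; apply/exists_inP; exists z => //.
exact: connect_trans yz.
Qed.

(** Cutting the path after its last vertex in [C] leaves a tail that avoids [C], which can then be
    decoupled from the event that [C] is a cluster. *)
Lemma last_exit v u A C x z : x \in C -> z \notin C -> conn v u A x z ->
  exists a b, [/\ a \in C, b \notin C, (a \in A) && (b \in A), opn v u a b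
    & conn v u (A :\: C) b z].
Proof.
move=> xC zC /connectP[p pth zE].
suff : conn v u (A :\: C) x z /\ x \notin C \/
  exists a b, [/\ a \in C, b \notin C, (a \in A) && (b \in A), opn v u a b
    & conn v u (A :\: C) b z] by case=> // -[_]; rewrite xC.
elim: p x pth zE {xC} => [|y p IH] x /=.
  by move=> _ <-; left; split => //; exact: connect0.
move=> /andP[/and3P[xA yA xy] pth] zE; have [[yz yC]|] := IH _ pth zE; last by right.
have [xC|xC] := boolP (x \in C); first by right; exists x, y; rewrite xA.
left; split => //; apply: connect_trans yz; apply: conn1 => //;
  by rewrite finset.in_setD ?xC ?yC.
Qed.

(** * Separating sets and local surgery *)

Section Surgery.
Variables (o : V) (D : {set V}).

(* The event that S is the set of vertices not connected to D, in a form that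
   involves no coordinate in the interior of S. *)
Definition separating S v u :=
  [forall a in S, forall b in ~: S, ~~ opn v u a b] &&
  [forall z in ~: S, hit v u (~: S) D z].

Definition disconnected v u := [set z | ~~ hit v u [set: V] D z]%SET.

Lemma disconnected_disjoint v u : [disjoint disconnected v u & D].
Proof.
apply/pred0P => z; apply/negP => /andP[/=]; rewrite inE => /negP zD zD'; apply: zD.
by apply/exists_inP; exists z => //; exact: connect0.
Qed.

Lemma disconnected_separating v u : separating (disconnected v u) v u.
Proof.
set S := disconnected v u.
have cl a b : a \in ~: S -> opn v u a b -> b \in ~: S.
  rewrite !inE !negbK => aD ab; apply: hit_conn aD.
  by rewrite conn_sym; apply: conn1; rewrite ?inE.
apply/andP; split; apply/forall_inP => z zS.
  apply/forall_inP => b bS; apply/negP; rewrite opn_sym => /(cl _ _ bS).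
  by rewrite inE zS.
have := zS; rewrite 2!inE negbK => /exists_inP[y yD zy]; apply/exists_inP; exists y => //.
by apply: conn_inside zy => // a b _ _ aS; exact: cl.
Qed.

(** Together with [disconnected_separating], this makes the events [separating S], for [S] disjoint
    from [D], a partition of the configurations. *)
Lemma separating_eq S v u : [disjoint S & D] -> separating S v u ->
  S = disconnected v u.
Proof.
move=> SD /andP[/forall_inP H1 /forall_inP H2]; apply/setP => z; rewrite inE.
apply/idP/negP => [zS /exists_inP[y yD zy]|zD].
  suff : y \in S by rewrite (disjointFl SD yD).
  apply: conn_closed zy => // a b _ _ aS ab; apply/negPn/negP => bS.
  by move: (forall_inP (H1 a aS) b); rewrite inE bS ab => /(_ isT).
apply/negPn/negP => zS; apply: zD; have := H2 z; rewrite inE => /(_ zS).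
by apply: sub_hit => a b _ _ ->; rewrite !inE.
Qed.

Definition bd S := [set x in S | [exists y, (y \notin S) && e x y]]%SET.
Definition itr S := S :\: bd S.
(* The junk value of [nb S x] is [x], for [x] outside [bd S]. *)
Definition nb S x := odflt x [pick y | (y \notin S) && e x y].

Lemma nbP S x : x \in bd S -> nb S x \notin S /\ e x (nb S x).
Proof.
rewrite inE => /andP[_ /existsP[y yS]]; rewrite /nb.
by case: pickP => [z /andP[]//|/(_ y)]; rewrite yS.
Qed.

Lemma bd_sub S x : x \in bd S -> x \in S.
Proof. by rewrite inE => /andP[]. Qed.

Lemma itr_sub S x : x \in itr S -> x \in S.
Proof. by case/finset.setDP. Qed.

Lemma itr_nb S x y : x \in itr S -> e x y -> y \in S.
Proof.
rewrite !inE => /andP[+ xS] xy; rewrite xS /=.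
by move=> /existsP H; apply/negPn/negP => yS; apply: H; exists y; rewrite yS.
Qed.

(** For [x] in [bd S], opening the edge from [x] to [nb S x] would connect [o] to [D]. The last
    condition keeps the index of this edge away from 0, where the opening probability has derivative
    0. *)
Definition pivotal_at S x v u :=
  [&& separating S v u, conn v u S o x & (1 <= zeta (v x) (v (nb S x)))%N].

(** These are the edges across the boundary of [S] that higher weights at [x] and [y] could open;
    the surgery closes them. *)
Definition cut_edges S x y : seq {set V} :=
  [seq [set x; z]%SET | z in [pred z | e x z && (z \notin S)]] ++
  [seq [set y; z]%SET | z in [pred z | e y z && (z \in S)]].

Lemma mem_cut_edges S x y s : x \in S -> y \notin S -> s \in cut_edges S x y ->
  exists a b, [/\ s = [set a; b]%SET, a \in S & b \notin S].
Proof.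
move=> xS yS; rewrite mem_cat => /orP[] /fintype.imageP[z]; rewrite inE => /andP[_ zS] ->.
  by exists x, z.
by exists z, y; rewrite finset.setUC.
Qed.

Lemma mem_set2 a b z : z \in [set a; b]%SET = (z == a) || (z == b).
Proof. by rewrite !inE. Qed.

Lemma cut_edges_notin S x y a b : x \in S -> y \notin S -> (a \in S) = (b \in S) ->
  [set a; b]%SET \notin cut_edges S x y.
Proof.
move=> xS yS ab; apply/negP => /(mem_cut_edges xS yS)[c [d [E cS dS]]].
have : c \in [set a; b]%SET by rewrite E mem_set2 eqxx.
have : d \in [set a; b]%SET by rewrite E mem_set2 eqxx orbT.
rewrite !mem_set2 => /orP[]/eqP dE /orP[]/eqP cE; move: cS dS; rewrite cE dE;
  by rewrite ?ab => ->.
Qed.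

(** Weights in [itr S] and levels of sets inside [S] are left free, for later use. Off [S], weights
    only grow and levels of edges are kept, so connections to [D] survive; across the boundary, an
    edge whose ends have changed weight is among those closed. *)
Lemma separating_surgery S x y v u v' u' : x \in S -> y \notin S ->
  (forall z, z \notin itr S ->
     v' z = if (z == x) || (z == y) then ord_max else v z) ->
  (forall s : {set V}, ~~ (s \subset S) ->
     u' s = if s \in cut_edges S x y then ord_max else u s) ->
  separating S v u -> separating S v' u'.
Proof.
move=> xS yS Hv Hu /andP[/forall_inP H1 /forall_inP H2].
have nsub a b : b \notin S -> ~~ ([set a; b]%SET \subset S).
  by move=> bS; apply: contra bS => /fintype.subsetP; apply; rewrite mem_set2 eqxx orbT.
apply/andP; split.
  apply/forall_inP => a aS; apply/forall_inP => b; rewrite inE => bS.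
  apply/negP => op; have /andP[ab] := op.
  have aI : a \notin itr S.
    by apply: contra bS => aI; exact: itr_nb ab.
  have bI : b \notin itr S by apply: contra bS => /itr_sub.
  rewrite Hu ?nsub //; case: ifPn => [_|cut].
    by rewrite leqNgt ltnS -ltnS ltn_ord.
  have ax : a != x.
    apply: contra cut => /eqP ax; rewrite mem_cat; apply/orP; left; apply/fintype.imageP.
    by exists b; rewrite ?ax // inE -ax ab bS.
  have bY : b != y.
    apply: contra cut => /eqP bY; rewrite mem_cat; apply/orP; right; apply/fintype.imageP.
    by exists a; rewrite ?bY 1?finset.setUC // inE -bY e_sym ab aS.
  have ay : a != y by apply: contra yS => /eqP <-.
  have bx : b != x by apply: contra bS => /eqP ->.
  rewrite !Hv // (negbTE ax) (negbTE ay) (negbTE bx) (negbTE bY) /= => us.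
  have := forall_inP (H1 a aS) b; rewrite inE bS => /(_ isT)/negP; apply.
  by rewrite /opn ab.
apply/forall_inP => z zS; apply: sub_hit (H2 z zS) => a b aS bS ab; rewrite aS bS /=.
move: aS bS; rewrite !inE => aS bS.
have vle t : t \notin S -> (v t <= v' t)%N.
  move=> tS; rewrite Hv; last by apply: contra tS => /itr_sub.
  by case: ifP => // _; rewrite -ltnS ltn_ord.
apply: opn_mono ab; rewrite ?vle // Hu ?nsub //.
by rewrite (negbTE (cut_edges_notin _ _ _)) // (negbTE aS) (negbTE bS).
Qed.

(** The maximal weights at [x'] and [x] and the level 1 open the edge between them, which prolongs
    the connection from [o] to the boundary vertex [x]. That connection stays in [itr S], which does
    not contain [x], so no level changed by the surgery belongs to it. *)
Lemma pivotal_surgery S x x' v u v' u' : x \in bd S -> x' \in itr S -> e x' x ->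
  o \in itr S -> (1 <= zeta ord_max ord_max)%N ->
  (forall z, v' z =
     if [|| z == x, z == nb S x | z == x'] then ord_max else v z) ->
  (forall s, u' s = if s == [set x'; x]%SET then inord 1
     else if s \in cut_edges S x (nb S x) then ord_max else u s) ->
  separating S v u -> conn v u (itr S) o x' -> pivotal_at S x v' u'.
Proof.
move=> xbd x'I x'x oI z1 Hv Hu sepS ox'.
have xS := bd_sub xbd; have [yS xy] := nbP xbd.
have x'S := itr_sub x'I.
have xI : x \notin itr S by rewrite inE xbd.
have vle t : (v t <= v' t)%N by rewrite Hv; case: ifP => // _; rewrite -ltnS ltn_ord.
apply/and3P; split.
- apply: (separating_surgery xS yS _ _ sepS) => [z zI|s sS].
    rewrite Hv; case: (z =P x') => [zx|]; first by rewrite zx x'I in zI.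
    by rewrite orbF.
  rewrite Hu; case: (s =P [set x'; x]%SET) => // sE; case/negP: sS.
  by apply/fintype.subsetP => t; rewrite sE mem_set2 => /orP[]/eqP->.
- have : conn v' u' S o x'.
    apply: conn_sub ox' => a b aI bI ab; rewrite (itr_sub aI) (itr_sub bI) /=.
    apply: opn_mono ab => //; rewrite Hu ifN; last first.
      by apply: contra xI => /eqP; move/setP/(_ x); rewrite !mem_set2 eqxx orbT
        => /orP[]/eqP->.
    by rewrite (negbTE (cut_edges_notin _ _ _)) // (itr_sub aI) (itr_sub bI).
  move/connect_trans; apply; apply: conn1 => //.
  by rewrite /opn x'x Hu eqxx !Hv !eqxx !orbT /= inordK.
- by rewrite !Hv !eqxx orbT.
Qed.

(** When [o] is itself on the boundary, the empty path replaces the connection in the interior. *)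
Lemma pivotal_surgery_bd S v u v' u' : o \in bd S -> (1 <= zeta ord_max ord_max)%N ->
  (forall z, v' z = if (z == o) || (z == nb S o) then ord_max else v z) ->
  (forall s, u' s = if s \in cut_edges S o (nb S o) then ord_max else u s) ->
  separating S v u -> pivotal_at S o v' u'.
Proof.
move=> obd z1 Hv Hu sepS; have [yS oy] := nbP obd.
apply/and3P; split; first exact: (separating_surgery (bd_sub obd) yS _ _ sepS).
- exact: connect0.
- by rewrite !Hv !eqxx orbT.
Qed.

End Surgery.

(** * Exploration of the cluster of a vertex *)

Section Expectation.
Variables (R : realFieldType) (q : 'I_N.+1 -> R) (m : {set V} -> 'I_M.+2 -> R).
Hypotheses (q_ge0 : forall k, 0 <= q k) (q_sum1 : \sum_k q k = 1).
Hypotheses (m_ge0 : forall s k, 0 <= m s k) (m_sum1 : forall s, \sum_k m s k = 1).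
Implicit Types (X Y : weights -> levels -> R).

(** The two families take values in different types, so the product expectation is iterated, with
    the levels inside. *)
Definition Ex2 X : R := Ex (fun _ : V => q) (fun v => Ex m (X v)).
Definition Pr2 (E : weights -> levels -> bool) : R := Ex2 (fun v u => (E v u)%:R).

Lemma Ex2_le X Y : (forall v u, X v u <= Y v u) -> Ex2 X <= Ex2 Y.
Proof. by move=> XY; apply: Ex_le => // v; apply: Ex_le => // u. Qed.

Lemma Ex2_cst c : Ex2 (fun _ _ => c) = c.
Proof.
by rewrite /Ex2; under eq_Ex => v do rewrite Ex_cst //; rewrite Ex_cst.
Qed.

Lemma Ex2_ge0 X : (forall v u, 0 <= X v u) -> 0 <= Ex2 X.
Proof. by move=> X0; rewrite -(Ex2_cst 0); apply: Ex2_le. Qed.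

Lemma Ex2_scale c X : Ex2 (fun v u => c * X v u) = c * Ex2 X.
Proof. by rewrite /Ex2 -Ex_scale; apply: eq_Ex => v; rewrite Ex_scale. Qed.

Lemma Ex2D X Y : Ex2 (fun v u => X v u + Y v u) = Ex2 X + Ex2 Y.
Proof. by rewrite /Ex2 -ExD; apply: eq_Ex => v; rewrite ExD. Qed.

Lemma Ex2_sum (J : Type) (r : seq J) (Q : pred J) (F : J -> weights -> levels -> R) :
  Ex2 (fun v u => \sum_(j <- r | Q j) F j v u) = \sum_(j <- r | Q j) Ex2 (F j).
Proof. by rewrite /Ex2 -Ex_sum; apply: eq_Ex => v; rewrite Ex_sum. Qed.

Lemma Pr2_ge0 E : 0 <= Pr2 E.
Proof. by apply: Ex2_ge0 => v u; rewrite ler0n. Qed.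

Lemma Pr2_le (E F : weights -> levels -> bool) :
  (forall v u, E v u -> F v u) -> Pr2 E <= Pr2 F.
Proof.
by move=> EF; apply: Ex2_le => v u; apply: ler_bool; exact: EF.
Qed.

Lemma Ex2_neg_corr X Y :
  (forall v s, neg_corr_in (@leqI _) s (X v) (Y v)) ->
  (forall x, [\/ (forall u, incr_in (@leqI _) x (X^~ u)) /\
                 (forall u, incr_in (fun k l => leqI l k) x (Y^~ u)),
               forall u, indep_of x (X^~ u) | forall u, indep_of x (Y^~ u)]) ->
  Ex2 (fun v u => X v u * Y v u) <= Ex2 X * Ex2 Y.
Proof.
move=> Hs Hx; pose EX v := Ex m (X v); pose EY v := Ex m (Y v).
apply: (@le_trans _ _ (Ex (fun _ : V => q) (fun v => EX v * EY v))).
  by apply: Ex_le => // v; exact: (Ex_neg_corr (@leqI_total _)).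
apply: (Ex_neg_corr (@leqI_total _)) => // x.
case: (Hx x) => [[iX dY]|iX|iY].
- by constructor 1; split => v k l kl; apply: Ex_le => // u; [exact: iX | exact: dY].
- by constructor 2 => v k; apply: eq_Ex => u; exact: iX.
- by constructor 3 => v k; apply: eq_Ex => u; exact: iY.
Qed.

(* The event that C is the cluster of o in A, in a form that involves only the
   weights of C and A and the levels of the edges that meet C. *)
Definition is_cluster o A C v u :=
  [forall z in C, conn v u C o z] &&
  [forall a in C, forall b in A :\: C, ~~ opn v u a b].

Lemma cluster_is_cluster o A v u : o \in A ->
  is_cluster o A [set z | conn v u A o z]%SET v u.
Proof.
move=> oA; set C := finset _; have CA : C \subset A.
  by apply/fintype.subsetP => z; rewrite inE => /conn_mem; apply.
apply/andP; split; apply/forall_inP => z; rewrite inE => oz; last first.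
  apply/forall_inP => b /finset.setDP[bA]; rewrite inE; apply: contra => zb.
  apply: connect_trans (oz) (conn1 _ _ zb) => //; exact: conn_mem oz.
apply: conn_inside (oz) => [|a b aA bA]; rewrite !inE; first exact: connect0.
by move=> oa ab; apply: connect_trans oa _; exact: conn1.
Qed.

Lemma cluster_eq o A C v u : o \in C -> C \subset A -> is_cluster o A C v u ->
  C = [set z | conn v u A o z]%SET.
Proof.
move=> oC CA /andP[/forall_inP cC /forall_inP bC]; apply/setP => z; rewrite inE.
apply/idP/idP => [zC|]; first by apply: (conn_subset CA); exact: cC.
apply: conn_closed => // a b aA bA aC ab; apply/negPn/negP => bC'.
by move/forall_inP: (bC a aC) => /(_ b); rewrite finset.in_setD bC' bA ab => /(_ isT).
Qed.

(** A level is read by at most one factor, according to whether its edge meets [C], and a weight in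
    [C] by the cluster event alone. What the factors share are the weights off [C], in which they
    are monotone in opposite directions. *)
Lemma cluster_hit_le o A C y D :
  Ex2 (fun v u => (hit v u (~: C) D y)%:R * (is_cluster o A C v u)%:R) <=
  Pr2 (fun v u => hit v u (~: C) D y) * Pr2 (is_cluster o A C).
Proof.
apply: Ex2_neg_corr => [v s|x].
- have [sC|sC] := boolP [disjoint s & C].
    constructor 3 => u k; congr ((nat_of_bool _)%:R); congr (_ && _).
      apply: eq_forallb_in => z zC; apply: eq_conn => a b aC bC; apply: opn_updr.
      by apply: contraL sC => /eqP <-; apply/pred0Pn; exists a; rewrite /= !inE eqxx.
    apply: eq_forallb_in => a aC; apply: eq_forallb_in => b bC; rewrite opn_updr //.
    by apply: contraL sC => /eqP <-; apply/pred0Pn; exists a; rewrite /= !inE eqxx.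
  constructor 2 => u k; congr ((nat_of_bool _)%:R); apply: eq_hit => a b.
  rewrite !inE => aC bC; rewrite opn_updr //; apply: contra sC => /eqP <-.
  by rewrite finset.disjoints_subset; apply/fintype.subsetP => z; rewrite !inE => /orP[]/eqP->.
- have neqC a b : a \in C -> b \notin C -> a != b.
    by move=> aC; apply: contra => /eqP <-.
  have [xC|xC] := boolP (x \in C).
    constructor 2 => u v k; congr ((nat_of_bool _)%:R); apply: eq_hit => a b.
    by rewrite !inE => aC bC; rewrite opn_updl // eq_sym neqC.
  constructor 1; split=> u v k k' kk'; apply: ler_bool.
    apply: sub_hit => a b aC bC ab; rewrite aC bC.
    exact: opn_updl_mono ab.
  move=> /andP[/forall_inP H1 /forall_inP H2]; apply/andP; split.
    apply/forall_inP => z zC; rewrite (eq_conn (v' := upd v x k) (u' := u)) ?H1 //.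
    by move=> a b aC bC; rewrite !opn_updl ?neqC.
  apply/forall_inP => a aC; apply/forall_inP => b bC.
  by apply: contra (forall_inP (H2 a aC) b bC); exact: opn_updl_mono.
Qed.

(** The configuration is split according to the cluster [C] of [o] in [A] and the last edge from [C]
    on a path to [D]. Once the continuation is decoupled from [C], its restriction to the complement
    of [C] is dropped. *)
Lemma exit_bound o A D : o \in A -> [disjoint A & D] ->
  Pr2 (fun v u => hit v u [set: V] D o) <=
  \sum_(x in A) \sum_(y | (y \notin A) && e x y)
    Pr2 (fun v u => conn v u A o x) * Pr2 (fun v u => hit v u [set: V] D y).
Proof.
move=> oA AD.
pose good C := (o \in C) && (C \subset A).
apply: (@le_trans _ _ (Ex2 (fun v u => \sum_(C | good C) \sum_(x in A)
   \sum_(y | (y \notin A) && e x y)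
   (x \in C)%:R * ((hit v u (~: C) D y)%:R * (is_cluster o A C v u)%:R)))).
  apply: Ex2_le => v u; have [/exists_inP[z zD oz]|_] := boolP (hit v u _ _ _); last first.
    by apply: sumr_ge0 => C _; apply: sumr_ge0 => x _; apply: sumr_ge0 => y _;
      rewrite -!natrM ler0n.
  set C := [set x | conn v u A o x]%SET.
  have zC : z \notin C.
    by rewrite inE; apply: contraTN zD => /(conn_mem oA)/(disjointFr AD) ->.
  have oC : o \in C by rewrite inE; exact: connect0.
  have CA : C \subset A by apply/fintype.subsetP => x; rewrite inE => /(conn_mem oA).
  have [x [y [xC yC _ xy yz]]] := last_exit oC zC oz.
  have xA : x \in A by exact: (fintype.subsetP CA).
  (* Inside [A], the open edge would put [y] in the cluster. *)
  have yA : y \notin A.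
    apply: contra yC => yA; move: xC; rewrite !inE => ox.
    by apply: connect_trans ox _; exact: conn1.
  apply: le_trans (ler_sum_term (j := C) _ _); rewrite /good ?oC ?CA //=; last first.
    by move=> ? _; apply: sumr_ge0 => ? _; apply: sumr_ge0 => ? _; rewrite -!natrM ler0n.
  apply: le_trans (ler_sum_term (j := x) _ _); rewrite //=; last first.
    by move=> ? _; apply: sumr_ge0 => ? _; rewrite -!natrM ler0n.
  apply: le_trans (ler_sum_term (j := y) _ _); rewrite ?yA /=; last 2 first.
  - by case/andP: xy.
  - by move=> ? _; rewrite -!natrM ler0n.
  rewrite xC cluster_is_cluster // (_ : hit _ _ _ _ _) ?mulr1 //.
  by apply/exists_inP; exists z => //; move: yz; rewrite finset.setTD.
rewrite Ex2_sum; under eq_bigr => C _.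
  rewrite Ex2_sum; under eq_bigr => x _.
    rewrite Ex2_sum; under eq_bigr => y _ do rewrite Ex2_scale.
    over.
  over.
rewrite exchange_big /=; apply: ler_sum => x xA.
rewrite exchange_big /=; apply: ler_sum => y _.
apply: (@le_trans _ _ (\sum_(C | good C) Ex2 (fun v u => (x \in C)%:R *
    (is_cluster o A C v u)%:R) * Pr2 (fun v u => hit v u [set: V] D y))).
  apply: ler_sum => C _; rewrite Ex2_scale -mulrA; apply: ler_wpM2l; first exact: ler0n.
  apply: le_trans (cluster_hit_le o A C y D) _; rewrite mulrC.
  apply: ler_wpM2l; first exact: Pr2_ge0.
  apply: Pr2_le => v u; apply: sub_hit => a b _ _ ->; by rewrite !inE.
rewrite -mulr_suml -Ex2_sum; apply: ler_wpM2r; first exact: Pr2_ge0.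
apply: Ex2_le => v u.
(* At most one [C] is the cluster, so summing over [C] restores the event that [o] is connected to
   [x] in [A]. *)
rewrite (bigID (pred1 [set z | conn v u A o z]%SET)) /= [X in _ + X]big1 ?addr0; last first.
  move=> C /andP[/andP[oC CA] neC]; case: (boolP (is_cluster _ _ _ _ _)); last by rewrite mulr0.
  by move=> /(cluster_eq oC CA) CE; rewrite CE eqxx in neC.
rewrite big_mkcond (bigD1 [set z | conn v u A o z]%SET) //= big1 ?addr0 ?eqxx ?andbT.
  case: ifP => _; rewrite ?ler0n // inE -natrM mulnb; apply: ler_bool.
  by case/andP.
by move=> C /negbTE ->; rewrite andbF.
Qed.

Lemma Ex2_indep X Y :
  (forall v s, indep_of s (X v) \/ indep_of s (Y v)) ->
  (forall x, (forall u, indep_of x (X^~ u)) \/ (forall u, indep_of x (Y^~ u))) ->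
  Ex2 (fun v u => X v u * Y v u) = Ex2 X * Ex2 Y.
Proof.
move=> Hs Hx; rewrite /Ex2.
under eq_Ex => v do rewrite (Ex_indep (@leqI_total _)) //.
rewrite (Ex_indep (@leqI_total _)) // => x.
by case: (Hx x) => H; [left | right] => v k; apply: eq_Ex => u; exact: H.
Qed.

Lemma Ex2_updl_le X x k : (forall v u, 0 <= X v u) ->
  q k * Ex2 (fun v u => X (upd v x k) u) <= Ex2 X.
Proof.
move=> X0; apply: (Ex_upd_le (m := fun=> q) (i := x)) => // v.
by rewrite -(Ex_cst 0 m_sum1); apply: Ex_le.
Qed.

Lemma Ex2_updr_le X s k : (forall v u, 0 <= X v u) ->
  m s k * Ex2 (fun v u => X v (upd u s k)) <= Ex2 X.
Proof.
by move=> X0; rewrite /Ex2 -Ex_scale; apply: Ex_le => // v; exact: Ex_upd_le.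
Qed.

Definition close_edges (l : seq {set V}) u := foldr (fun s w => upd w s ord_max) u l.

Lemma close_edgesE l u s :
  close_edges l u s = if s \in l then ord_max else u s.
Proof. by elim: l => //= t l IH; rewrite updE IH in_cons; case: (s == t). Qed.

Lemma Ex2_close_le c l X : 0 <= c -> (forall s, c <= m s ord_max) ->
  (forall v u, 0 <= X v u) ->
  c ^+ size l * Ex2 (fun v u => X v (close_edges l u)) <= Ex2 X.
Proof.
move=> c0 cm; elim: l X => [|s l IH] X X0 /=; first by rewrite expr0 mul1r.
rewrite exprS -mulrA; apply: le_trans (Ex2_updr_le s ord_max X0).
have Y0 v u : 0 <= X v (upd u s ord_max) by [].
apply: le_trans (_ : _ <= c * Ex2 (fun v u => X v (upd u s ord_max))) _.
  by apply: ler_wpM2l => //; exact: (IH _ Y0).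
by apply: ler_wpM2r => //; exact: Ex2_ge0.
Qed.

(** * Cost of the surgery *)

Section Differential.
Variables (o : V) (D : {set V}) (deg : nat) (c1 c2 kappa : R).
Hypothesis deg_le : forall x, (#|[pred y | e x y]| <= deg)%N.
Hypothesis zeta_max : (1 <= zeta ord_max ord_max)%N.
Hypotheses (c1_gt0 : 0 < c1) (c1_le1 : c1 <= 1) (c2_gt0 : 0 < c2) (c2_le1 : c2 <= 1).
Hypothesis m_max : forall s, c1 <= m s ord_max.
Hypothesis m_1 : forall x y, e x y -> c2 <= m [set x; y]%SET (inord 1).
Hypotheses (kappa_ge0 : 0 <= kappa) (kappa_le1 : kappa <= 1).
Hypothesis kappa_le : forall A, o \in A -> [disjoint A & D] ->
  kappa <= \sum_(x in bd A) Pr2 (fun v u => conn v u A o x).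

(** The price of the surgery: three weights N, one level 1 and at most 2 deg closed edges. *)
Notation cs := (q ord_max ^+ 3 * c2 * c1 ^+ (deg + deg)).

Lemma size_cut_edges S x y : (size (cut_edges S x y) <= deg + deg)%N.
Proof.
rewrite size_cat !size_map -!cardE; apply: leq_add.
  apply: leq_trans (deg_le x); apply: subset_leq_card.
  by apply/fintype.subsetP => z; rewrite !inE => /andP[].
apply: leq_trans (deg_le y); apply: subset_leq_card.
by apply/fintype.subsetP => z; rewrite !inE => /andP[].
Qed.

Lemma Ex2_cut_le S x y X : (forall v u, 0 <= X v u) ->
  c1 ^+ (deg + deg) * Ex2 (fun v u => X v (close_edges (cut_edges S x y) u)) <= Ex2 X.
Proof.
move=> X0; apply: le_trans (Ex2_close_le (cut_edges S x y) (ltW c1_gt0) m_max X0).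
apply: ler_wpM2r; first exact: Ex2_ge0.
by apply: ler_wiXn2l => //; [exact: ltW | exact: size_cut_edges].
Qed.

(** An interior vertex has no neighbour off [S]. Hence [separating] reads only weights outside
    [itr S] and levels of sets not contained in [S], whereas the connection reads only weights in
    [itr S] and levels of its subsets. *)
Lemma separating_conn_indep S x :
  Ex2 (fun v u => (separating D S v u)%:R * (conn v u (itr S) o x)%:R) =
  Pr2 (separating D S) * Pr2 (fun v u => conn v u (itr S) o x).
Proof.
apply: Ex2_indep => [v s|y].
- have [sS|sS] := boolP (s \subset S).
    have ns a b : (a \notin S) || (b \notin S) -> [set a; b]%SET != s.
      rewrite orbC; apply: contraTneq => E; rewrite negb_or !negbK.
      by rewrite !(fintype.subsetP sS) // -E mem_set2 eqxx ?orbT.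
    left => u k; congr ((nat_of_bool _)%:R); congr (_ && _).
      apply: eq_forallb_in => a aS; apply: eq_forallb_in => b; rewrite inE => bS.
      by rewrite opn_updr // ns // bS orbT.
    apply: eq_forallb_in => z zS; apply: eq_hit => a b; rewrite !inE => aS bS.
    by rewrite opn_updr // ns // aS.
  right => u k; congr ((nat_of_bool _)%:R); apply: eq_conn => a b aI bI.
  rewrite opn_updr //; apply: contra sS => /eqP <-; apply/fintype.subsetP => z.
  by rewrite mem_set2 => /orP[]/eqP ->; exact: itr_sub.
- have [yI|yI] := boolP (y \in itr S).
    left => u v k; congr ((nat_of_bool _)%:R); congr (_ && _).
      apply: eq_forallb_in => a aS; apply: eq_forallb_in => b; rewrite inE => bS.
      have [ay|ay] := eqVneq a y.
        have : ~~ e a b by apply: contra bS => ab; apply: itr_nb ab; rewrite ay.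
        by rewrite /opn => /negbTE ->.
      by rewrite opn_updl //; apply: contra bS => /eqP ->; exact: itr_sub.
    apply: eq_forallb_in => z zS; apply: eq_hit => a b; rewrite !inE => aS bS.
    by rewrite opn_updl //; [apply: contra aS | apply: contra bS] => /eqP ->;
      exact: itr_sub.
  right => u v k; congr ((nat_of_bool _)%:R); apply: eq_conn => a b aI bI.
  by rewrite opn_updl //; apply: contra yI => /eqP <-.
Qed.

(** The coordinates changed by [pivotal_surgery] are prescribed one at a time, each at the cost of
    the probability of its prescribed value. *)
Lemma pivotal_itr_ge S x x' : x \in bd S -> x' \in itr S -> e x' x -> o \in itr S ->
  cs * (Pr2 (separating D S) * Pr2 (fun v u => conn v u (itr S) o x')) <=
  Pr2 (pivotal_at o D S x).
Proof.
move=> xbd x'I x'x oI; rewrite -separating_conn_indep.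
pose X v u : R := (pivotal_at o D S x v u)%:R.
have X0 v u : 0 <= X v u by exact: ler0n.
set y := nb S x; set l := cut_edges S x y; set s := [set x'; x]%SET.
pose X1 v u := X (upd v x ord_max) u.
pose X2 v u := X1 (upd v y ord_max) u.
pose X3 v u := X2 (upd v x' ord_max) u.
pose X4 v u := X3 v (upd u s (inord 1)).
have q0 := q_ge0 ord_max.
apply: le_trans (Ex2_updl_le x ord_max X0).
rewrite -/X1 !exprS expr0 mulr1 -!mulrA; apply: ler_wpM2l => //.
apply: le_trans (Ex2_updl_le (X := X1) y ord_max _) => //.
rewrite -/X2 mulrA -mulrA; apply: ler_wpM2l => //.
apply: le_trans (Ex2_updl_le (X := X2) x' ord_max _) => //.
rewrite -/X3; apply: ler_wpM2l => //.
apply: le_trans (Ex2_updr_le (X := X3) s (inord 1) _) => //.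
apply: (@le_trans _ _ (c2 * Ex2 X4)); last first.
  by apply: ler_wpM2r; [exact: Ex2_ge0 | exact: m_1].
apply: ler_wpM2l; first exact: ltW.
apply: le_trans (Ex2_cut_le S x y (X := X4) _) => //.
apply: ler_wpM2l; first by rewrite exprn_ge0 // ltW.
apply: Ex2_le => v u; rewrite -natrM mulnb; apply: ler_bool => /andP[sep ox'].
apply: (pivotal_surgery xbd x'I x'x oI zeta_max _ _ sep ox') => [z|t].
  by rewrite !updE -/y; case: (z == x); case: (z == y); case: (z == x').
by rewrite updE close_edgesE.
Qed.

Lemma pivotal_bd_ge S : o \in bd S ->
  cs * Pr2 (separating D S) <= Pr2 (pivotal_at o D S o).
Proof.
move=> obd; pose X v u : R := (pivotal_at o D S o v u)%:R.
have X0 v u : 0 <= X v u by exact: ler0n.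
set y := nb S o.
pose X1 v u := X (upd v o ord_max) u.
pose X2 v u := X1 (upd v y ord_max) u.
have q0 := q_ge0 ord_max.
have q1 : q ord_max <= 1.
  by rewrite -q_sum1 (bigD1 ord_max) //= lerDl; apply: sumr_ge0.
have Pr0 := Pr2_ge0 (separating D S).
have cd0 : 0 <= c1 ^+ (deg + deg) by rewrite exprn_ge0 // ltW.
apply: le_trans (Ex2_updl_le o ord_max X0).
rewrite -/X1 !exprS expr0 mulr1 -!mulrA; apply: ler_wpM2l => //.
apply: le_trans (Ex2_updl_le (X := X1) y ord_max _) => //.
rewrite -/X2; apply: ler_wpM2l => //.
apply: le_trans (Ex2_cut_le S o y (X := X2) _) => //.
(* Here two weights suffice: the factors left over from [cs], one q(N) and c2, are at most 1. *)
apply: (@le_trans _ _ (c1 ^+ (deg + deg) * Pr2 (separating D S))).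
  rewrite !mulrA; apply: ler_wpM2r => //.
  rewrite -[leRHS]mul1r; apply: ler_wpM2r => //.
  by rewrite -[leRHS]mul1r; apply: ler_pM => //; exact: ltW.
apply: ler_wpM2l => //.
apply: Ex2_le => v u; apply: ler_bool => sep.
apply: (pivotal_surgery_bd obd zeta_max _ _ sep) => [z|t].
  by rewrite !updE -/y; case: (z == o); case: (z == y).
by rewrite close_edgesE.
Qed.

Lemma cs_ge0 : 0 <= cs.
Proof.
by rewrite mulr_ge0 ?exprn_ge0 ?(ltW c1_gt0) // mulr_ge0 ?exprn_ge0 ?(ltW c2_gt0).
Qed.

(** The lower bound on the boundary sum is applied to [itr S], whose configuration is independent of
    the separation. A vertex of [bd (itr S)] has a neighbour outside [itr S], which must lie in
    [bd S]; each vertex of [bd S] is chosen at most [deg] times. *)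
Lemma pivotal_sum_ge S : o \in S -> [disjoint S & D] -> (1 <= deg)%N ->
  cs * kappa * Pr2 (separating D S) <=
  deg%:R * \sum_(x in bd S) Pr2 (pivotal_at o D S x).
Proof.
move=> oS SD deg1; have Pr0 := Pr2_ge0 (separating D S); have cs0 := cs_ge0.
have sum0 (Q : pred V) : 0 <= \sum_(x | Q x) Pr2 (pivotal_at o D S x).
  by apply: sumr_ge0 => x _; exact: Pr2_ge0.
have [obd|obd] := boolP (o \in bd S).
  apply: (@le_trans _ _ (Pr2 (pivotal_at o D S o))).
    apply: le_trans (pivotal_bd_ge obd); apply: ler_wpM2r => //.
    by rewrite -[leRHS]mulr1; apply: ler_wpM2l.
  apply: (@le_trans _ _ (\sum_(x in bd S) Pr2 (pivotal_at o D S x))).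
    by apply: (ler_sum_term (F := fun x => Pr2 (pivotal_at o D S x))) => // x _;
      exact: Pr2_ge0.
  by rewrite -[leLHS]mul1r; apply: ler_wpM2r => //; rewrite ler1n.
have oI : o \in itr S by rewrite finset.in_setD obd oS.
have SI : itr S \subset S by apply/fintype.subsetP => z; exact: itr_sub.
apply: (@le_trans _ _ (cs * (Pr2 (separating D S) *
    \sum_(x in bd (itr S)) Pr2 (fun v u => conn v u (itr S) o x)))).
  rewrite -mulrA; apply: ler_wpM2l => //; rewrite mulrC; apply: ler_wpM2l => //.
  by apply: kappa_le => //; exact: disjointWl SI SD.
rewrite !mulr_sumr.
apply: (@le_trans _ _ (\sum_(x' in bd (itr S))
    Pr2 (pivotal_at o D S (nb (itr S) x')))).
  apply: ler_sum => x' x'bd; have [xI x'x] := nbP x'bd.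
  have x'I := bd_sub x'bd; apply: pivotal_itr_ge => //.
  by move: xI; rewrite finset.in_setD (itr_nb x'I x'x) andbT negbK.
rewrite (partition_big (nb (itr S)) (mem (bd S))) /=; last first.
  move=> x' x'bd; have [xI x'x] := nbP x'bd.
  by move: xI; rewrite finset.in_setD (itr_nb (bd_sub x'bd) x'x) andbT negbK.
apply: ler_sum => x xbd.
rewrite (eq_bigr (fun=> Pr2 (pivotal_at o D S x))); last by move=> ? /andP[_ /eqP ->].
rewrite sumr_const -[leLHS]mulr_natl; apply: ler_wpM2r; first exact: Pr2_ge0.
rewrite ler_nat; apply: leq_trans (deg_le x); apply: subset_leq_card.
apply/fintype.subsetP => x'; rewrite !inE => /andP[x'bd /eqP <-].
by rewrite e_sym; case: (nbP (S := itr S) (x := x')) => //; rewrite !inE.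
Qed.

(** * Influences and the differential inequality *)

Section Russo.
Variables (dm : {set V} -> 'I_M.+2 -> R) (c : R).
Hypothesis c_ge0 : 0 <= c.
Hypothesis dm_nonedge : forall (s : {set V}) k,
  (forall x y, e x y -> s != [set x; y]%SET) -> dm s k = 0.
Hypothesis dm_sum0 : forall s, \sum_k dm s k = 0.
Hypothesis dm_ge0 : forall x y (j : 'I_M.+1), e x y ->
  0 <= \sum_(k : 'I_M.+2 | (k <= j)%N) dm [set x; y]%SET k.
Hypothesis dm_gec : forall x y (j : 'I_M.+1), e x y -> (1 <= j)%N ->
  c <= \sum_(k : 'I_M.+2 | (k <= j)%N) dm [set x; y]%SET k.

Definition hitR v u : R := (hit v u [set: V] D o)%:R.
(** The term of coordinate [s] in Russo's formula, before averaging over the other coordinates. *)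
Definition influence v u s : R := avg (dm s) s (hitR v) u.

(** The level is read only through its comparison with [zeta (v x) (v y)], so [threshold_sum]
    applies; the second factor is the indicator that the edge is pivotal. *)
Lemma influence_edge v u x y : e x y ->
  influence v u [set x; y]%SET =
  (\sum_(k : 'I_M.+2 | (k <= zeta (v x) (v y))%N) dm [set x; y]%SET k) *
  (hitR v (upd u [set x; y]%SET ord0) - hitR v (upd u [set x; y]%SET ord_max)).
Proof.
move=> exy; set s := [set x; y]%SET; set j := zeta (v x) (v y).
have opnE (k k' : 'I_M.+2) : (k <= j)%N = (k' <= j)%N -> hitR v (upd u s k) = hitR v (upd u s k').
  move=> kk.
  suff H : {in [set: V]%SET &, forall a b, opn v (upd u s k) a b = opn v (upd u s k') a b}.
    by rewrite /hitR (eq_hit _ _ H).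
  move=> a b _ _; rewrite /opn !updE; case: (_ =P s) => // E; congr (_ && _).
  suff -> : zeta (v a) (v b) = j by [].
  have [aS bS] : a \in s /\ b \in s by rewrite -E !mem_set2 !eqxx orbT.
  have [xS yS] : x \in [set a; b]%SET /\ y \in [set a; b]%SET.
    by rewrite E !mem_set2 !eqxx orbT.
  move: aS bS xS yS; rewrite !mem_set2 /j.
  move=> /orP[]/eqP-> /orP[]/eqP->; rewrite ?orbb // => /eqP ? /eqP ?; subst; by rewrite ?zeta_sym.
exact: (threshold_sum (j := j) (dm_sum0 s) opnE).
Qed.

Lemma influence_ge0 v u s : 0 <= influence v u s.
Proof.
have [/existsP[x /existsP[y /andP[exy /eqP->]]]|ns] :=
  boolP [exists x, exists y, e x y && (s == [set x; y]%SET)].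
  rewrite influence_edge //; apply: mulr_ge0; first exact: dm_ge0.
  rewrite subr_ge0; apply: ler_bool; apply: sub_hit => a b _ _ ab.
  by rewrite !inE /=; apply: opn_updr_mono ab.
rewrite /influence /avg big1 // => k _; rewrite dm_nonedge ?mul0r // => x y exy.
by apply: contra ns => sE; apply/existsP; exists x; apply/existsP; exists y; rewrite exy.
Qed.

(** Level 0 joins the connection from [o] to [x] in [S] to the one from [nb S x] to [D] off [S].
    Level [ord_max] opens nothing that was closed in [u], where [o] is disconnected from [D]. *)
Lemma influence_pivotal S x v u : x \in bd S -> o \in S -> [disjoint S & D] ->
  c * (pivotal_at o D S x v u)%:R <= influence v u [set x; nb S x]%SET.
Proof.
move=> xbd oS SD; have [yS xy] := nbP xbd; have xS := bd_sub xbd.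
have [/and3P[sep ox z1]|_] := boolP (pivotal_at _ _ _ _ _ _); last first.
  by rewrite mulr0; exact: influence_ge0.
rewrite influence_edge // mulr1; set y := nb S x in yS xy z1 *; set s := [set x; y]%SET.
have -> : hitR v (upd u s ord0) = 1.
  rewrite /hitR (_ : hit _ _ _ _ _) //; case/andP: sep => _ /forall_inP/(_ y).
  rewrite inE yS => /(_ isT) yD.
  have sE a b : (a \in S) = (b \in S) -> [set a; b]%SET != s.
    move=> ab; apply: contraTneq xS => E.
    have : x \in [set a; b]%SET by rewrite E mem_set2 eqxx.
    have : y \in [set a; b]%SET by rewrite E mem_set2 eqxx orbT.
    rewrite !mem_set2 => /orP[]/eqP yE /orP[]/eqP ->; move: yS; rewrite yE;
      by rewrite ?ab.
  have yD' : hit v (upd u s ord0) [set: V] D y.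
    apply: sub_hit yD => a b; rewrite !inE => aS bS ab.
    by rewrite opn_updr // sE // (negbTE aS) (negbTE bS).
  apply: hit_conn yD'; apply: connect_trans (_ : conn v (upd u s ord0) [set: V] o x) _.
    by apply: conn_sub ox => a b aS bS ab; rewrite !inE opn_updr // sE // aS bS.
  by apply: conn1; rewrite ?inE // /opn xy updE eqxx.
have -> : hitR v (upd u s ord_max) = 0.
  rewrite /hitR (_ : hit _ _ _ _ _ = false) //; apply/negbTE.
  have oD : ~~ hit v u [set: V] D o.
    by move: oS; rewrite (separating_eq SD sep) inE.
  apply: contra oD; apply: sub_hit => a b _ _; rewrite !inE /= => ab.
  by rewrite -(upd_id u s); apply: opn_updr_mono ab; rewrite -ltnS ltn_ord.
by rewrite subr0 mulr1; exact: dm_gec.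
Qed.

(** Only S = [disconnected D v u] contributes on the left. Its edges from [x] to [nb S x] are
    distinct for distinct [x], since [x] is their only end in S, so no influence is counted
    twice. *)
Lemma influence_sum_ge v u :
  c * \sum_(S : {set V} | (o \in S) && [disjoint S & D]) \sum_(x in bd S)
    (pivotal_at o D S x v u)%:R <= \sum_(s : {set V}) influence v u s.
Proof.
have inf0 : 0 <= \sum_(s : {set V}) influence v u s by apply: sumr_ge0 => s _; exact: influence_ge0.
set Z := disconnected D v u.
have zero S : (o \in S) && [disjoint S & D] -> S != Z ->
    \sum_(x in bd S) (pivotal_at o D S x v u)%:R = 0 :> R.
  move=> /andP[oS SD] SZ; apply: big1 => x _.
  by case: (boolP (pivotal_at _ _ _ _ _ _)) => // /and3P[/(separating_eq SD) E];
    rewrite E eqxx in SZ.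
have [oZ|oZ] := boolP (o \in Z); last first.
  rewrite big1 ?mulr0 // => S SP; apply: (zero _ SP).
  by apply: contra oZ => /eqP <-; case/andP: SP.
have ZD := disconnected_disjoint D v u.
rewrite (bigD1 Z) ?oZ //= [X in _ + X]big1 ?addr0; last by move=> S /andP[]; exact: zero.
rewrite mulr_sumr.
apply: (@le_trans _ _ (\sum_(x in bd Z) influence v u [set x; nb Z x]%SET)).
  by apply: ler_sum => x xbd; exact: influence_pivotal.
rewrite -(big_imset (h := fun x => [set x; nb Z x]%SET) (influence v u)) /=; last first.
  move=> x x' xb x'b E; have : x \in [set x'; nb Z x']%SET by rewrite -E mem_set2 eqxx.
  rewrite mem_set2 => /orP[/eqP//|/eqP xE].
  by have [] := nbP x'b; rewrite -xE (bd_sub xb).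
rewrite [leRHS](bigID (mem [set [set x; nb Z x]%SET | x in bd Z]%SET)) /= lerDl.
by apply: sumr_ge0 => s _; exact: influence_ge0.
Qed.

Lemma differential_inequality : (1 <= deg)%N ->
  c * (cs * kappa) * (1 - Ex2 hitR) <=
  deg%:R * Ex2 (fun v u => \sum_(s : {set V}) influence v u s).
Proof.
move=> deg1.
apply: (@le_trans _ _ (c * \sum_(S : {set V} | (o \in S) && [disjoint S & D])
    (cs * kappa * Pr2 (separating D S)))).
  rewrite -mulrA -mulr_sumr; apply: ler_wpM2l => //; apply: ler_wpM2l.
    by rewrite mulr_ge0 // cs_ge0.
  (* When [o] does not hit [D], the set [disconnected D v u] contains [o] and is separating, so the
     events [separating D S] cover the complement of the hit event. *)
  rewrite -Ex2_sum lerBlDl -[leLHS](Ex2_cst 1).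
  rewrite -Ex2D.
  apply: Ex2_le => v u; rewrite /hitR; case: (boolP (hit _ _ _ _ _)) => oD.
    by rewrite lerDl; apply: sumr_ge0.
  rewrite add0r; apply: le_trans (ler_sum_term (j := disconnected D v u) _ _) => //=.
    by rewrite disconnected_separating lexx.
  by rewrite inE oD disconnected_disjoint.
rewrite mulr_sumr.
apply: (@le_trans _ _ (\sum_(S : {set V} | (o \in S) && [disjoint S & D])
   deg%:R * (c * \sum_(x in bd S) Pr2 (pivotal_at o D S x)))).
  apply: ler_sum => S /andP[oS SD]; rewrite [leRHS]mulrCA; apply: ler_wpM2l => //.
  exact: pivotal_sum_ge.
rewrite -mulr_sumr; apply: ler_wpM2l => //; rewrite -mulr_sumr.
apply: le_trans (Ex2_le influence_sum_ge); rewrite Ex2_scale; apply: ler_wpM2l => //.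
by rewrite Ex2_sum; apply: ler_sum => S _; rewrite Ex2_sum.
Qed.
End Russo.
End Differential.
End Expectation.
End FinitePercolation.

(** * Differentiation of expectations *)

Section Derivative.
Variable R : realType.

Lemma is_derive_bigsum (J : Type) (r : seq J) (F : J -> R -> R) (dF : J -> R) (x : R) :
  (forall j, is_derive x 1 (F j) (dF j)) ->
  is_derive x 1 (fun y => \sum_(j <- r) F j y) (\sum_(j <- r) dF j).
Proof.
move=> HF; elim: r => [|j r IH].
  rewrite big_nil (_ : (fun y => _) = cst 0); first exact: is_derive_cst.
  by apply/funext => y; rewrite big_nil.
rewrite big_cons (_ : (fun y => _) = F j + (fun y => \sum_(j <- r) F j y)).
  exact: is_deriveD.
by apply/funext => y; rewrite big_cons.
Qed.

Lemma is_derive_bigprod (J : eqType) (r : seq J) (F : J -> R -> R) (dF : J -> R) (x : R) :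
  uniq r -> (forall j, is_derive x 1 (F j) (dF j)) ->
  is_derive x 1 (fun y => \prod_(j <- r) F j y)
    (\sum_(j <- r) dF j * \prod_(i <- r | i != j) F i x).
Proof.
move=> + HF; elim: r => [_|j r IH /andP[jr ur]].
  rewrite big_nil (_ : (fun y => _) = cst 1); first exact: is_derive_cst.
  by apply/funext => y; rewrite big_nil.
rewrite (_ : (fun y => _) = F j * (fun y => \prod_(j <- r) F j y)); last first.
  by apply/funext => y; rewrite big_cons.
apply: is_derive_eq; first exact: (is_deriveM (HF j) (IH ur)).
rewrite !big_cons eqxx /= addrC /GRing.scale /= mulr_sumr [_ * dF j]mulrC; congr (_ + _).
  rewrite [in RHS]big_seq_cond [in LHS]big_seq; congr (dF j * _).
  by apply: eq_bigl => i; case: (boolP (i \in r)) => //= ir; apply/esym;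
    apply: contraNneq jr => <-.
rewrite !big_seq; apply: eq_bigr => i ir; rewrite big_cons ifT.
  by rewrite mulrCA.
by apply: contraNneq jr => ->.
Qed.

(** Russo's formula: the product rule replaces one factor at a time by its derivative, and
    [Ex_resample] turns each term into an expectation. *)
Lemma is_derive_Ex (I K : finType) (m : R -> I -> K -> R) (dm : I -> K -> R)
    (X : {ffun I -> K} -> R) (x : R) :
  (forall i, \sum_k m x i k = 1) ->
  (forall i k, is_derive x 1 (fun y => m y i k) (dm i k)) ->
  is_derive x 1 (fun y => Ex (m y) X) (\sum_i Ex (m x) (avg (dm i) i X)).
Proof.
move=> m1 Hm.
apply: is_derive_eq.
  apply: (@is_derive_bigsum _ _ (fun (f : {ffun I -> K}) y => (\prod_i m y i (f i)) * X f)) => f.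
  rewrite (_ : (fun y => _) = (fun y => \prod_i m y i (f i)) * cst (X f)) //.
  apply: is_deriveM; first
    exact: (@is_derive_bigprod _ _ (fun i y => m y i (f i)) _ _ (index_enum_uniq _)).
rewrite /= [RHS](eq_bigr (fun i => \sum_(f : {ffun I -> K})
    (dm i (f i) * \prod_(j | j != i) m x j (f j)) * X f)); last first.
  by move=> i _; rewrite Ex_resample.
rewrite exchange_big /=; apply: eq_bigr => f _.
by rewrite scaler0 add0r /GRing.scale /= mulrC mulr_suml.
Qed.
End Derivative.

(** * The law of finite configurations *)

Section UniformLevels.
Variables (R : realType) (M : nat) (h : 'I_M.+1 -> R -> R).
Hypothesis h_range : forall m beta, 0 < beta -> 0 <= h m beta < 1.
Hypothesis h_lt : forall (m m' : 'I_M.+1) beta, 0 < beta -> (m < m')%N ->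
    h m beta < h m' beta.

Lemma uniform_prob_ray (c : R) : 0 <= c <= 1 ->
  uniform_prob (@ltr01 R) `]-oo, c]%classic = c%:E.
Proof.
move=> /andP[c0 c1]; rewrite /uniform_prob integral_uniform_pdf.
have -> : (`]-oo, c] `&` `[0%R, 1%R] = `[0%R, c])%classic.
  apply/seteqP; split => x /=; rewrite !in_itv /= => *; [|]; lra.
rewrite (eq_integral (fun=> 1%:E)); last first.
  move=> x; rewrite inE /= in_itv /= => /andP[x0 xc]; rewrite /uniform_pdf x0 /=.
  by rewrite (le_trans xc c1) /= subr0 invr1.
rewrite integral_cst //= lebesgue_measure_itv /= lte_fin mul1e.
case: ltP => [_|]; first by rewrite oppr0 adde0.
by move=> c0'; congr EFin; apply/eqP; rewrite eq_le c0 c0'.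
Qed.

Definition level beta (t : R) : 'I_M.+2 :=
  inord #|[set j : 'I_M.+1 | h j beta < t]%SET|.

(** The probability that the level is below [k]. Level 0 thus has mass h_0 and level M + 1 has mass
    1 - h_M. *)
Definition cum beta (k : nat) : R :=
  if k is j.+1 then (if (j <= M)%N then h (inord j) beta else 1) else 0.

Definition mlev beta (k : 'I_M.+2) : R := cum beta k.+1 - cum beta k.

Lemma cum_lt beta k : 0 < beta -> (0 < k <= M)%N -> cum beta k < cum beta k.+1.
Proof.
case: k => // k b0 /andP[_ kM]; rewrite /= kM (ltnW kM).
by apply: h_lt => //; rewrite !inordK // ltnS ltnW.
Qed.

Lemma cumS beta (j : 'I_M.+1) : cum beta j.+1 = h j beta.
Proof. by rewrite /= -ltnS ltn_ord inord_val. Qed.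

Lemma mlev_ge0 beta k : 0 < beta -> 0 <= mlev beta k.
Proof.
move=> b0; rewrite /mlev subr_ge0; case: k => -[|k] /= kM.
  by case/andP: (h_range (inord 0) b0).
have [kM'|kM'] := boolP (k.+1 <= M)%N.
  by have /ltW := @cum_lt beta k.+1 b0 kM'; rewrite /= kM'.
by rewrite (_ : (k <= M)%N) //; case/andP: (h_range (inord k) b0) => _ /ltW.
Qed.

Lemma telescope_ord_le (g : nat -> R) (j : nat) :
  \sum_(k : 'I_M.+2 | (k <= j)%N) (g k.+1 - g k) = g (minn j.+1 M.+2) - g 0%N.
Proof.
rewrite -(big_mkord (fun k => k <= j)%N (fun k => g k.+1 - g k)).
rewrite (big_cat_nat (n := minn j.+1 M.+2)) //= ?geq_minr //.
rewrite [X in _ + X]big_nat_cond [X in _ + X]big1 ?addr0; last first.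
  move=> i; rewrite geq_min ltnNge => /andP[/andP[+ iM] ij].
  by case: (leqP i j) ij => //= ij _; case: ltnP iM => //.
rewrite big_nat_cond (eq_bigl (fun i => (0 <= i < minn j.+1 M.+2)%N)); last first.
  by move=> i; rewrite ltn_min ltnS; case: (i <= j)%N; rewrite ?andbT ?andbF.
by rewrite -big_nat telescope_sumr.
Qed.

Lemma sum_mlev_le beta j :
  \sum_(k : 'I_M.+2 | (k <= j)%N) mlev beta k = cum beta (minn j.+1 M.+2).
Proof. by rewrite telescope_ord_le subr0. Qed.

Lemma sum_mlev beta : \sum_k mlev beta k = 1.
Proof.
rewrite (eq_bigl (fun k : 'I_M.+2 => k <= M.+1)%N); last first.
  by move=> k; rewrite -ltnS ltn_ord.
by rewrite sum_mlev_le minnn /= ltnn.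
Qed.

(** Since h_m increases with m, the indices with h_m < t form an initial segment, and their number
    decides whether j is among them. *)
Lemma level_le beta t (j : 'I_M.+1) : 0 < beta ->
  (level beta t <= j)%N = (t <= h j beta).
Proof.
move=> b0; set S := [set j : 'I_M.+1 | h j beta < t]%SET.
have hle (i i' : 'I_M.+1) : (i <= i')%N -> h i beta <= h i' beta.
  by rewrite leq_eqVlt => /orP[/eqP/val_inj ->//|/(h_lt b0)/ltW].
have SM : (#|S| < M.+2)%N.
  by rewrite ltnS; apply: leq_trans (max_card _) _; rewrite card_ord.
have cardle (k : nat) : (k <= M.+1)%N -> #|[set i : 'I_M.+1 | (i < k)%N]%SET| = k.
  move=> kM; rewrite -sum1_card (eq_bigl (fun i : 'I_M.+1 => i < k)%N).
    by rewrite (big_ord_narrow kM) sum1_card card_ord.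
  by move=> i; rewrite inE.
rewrite /level inordK //; apply/idP/idP => [Sj|tj].
  rewrite leNgt; apply/negP => jt; move: Sj; apply/negP; rewrite -ltnNge.
  rewrite -[X in (X <= _)%N](cardle j.+1) //; apply: subset_leq_card.
  apply/fintype.subsetP => i; rewrite !inE ltnS => ij.
  exact: le_lt_trans (hle _ _ ij) jt.
rewrite -[X in (_ <= X)%N](cardle j); last exact: ltnW.
apply: subset_leq_card; apply/fintype.subsetP => i; rewrite !inE => it.
rewrite ltnNge; apply/negP => /hle hji.
by have := lt_le_trans it (le_trans tj hji); rewrite ltxx.
Qed.

Lemma level_lt_set beta (k : nat) : 0 < beta -> (k <= M.+2)%N ->
  measurable [set t | (level beta t < k)%N]%classic /\
  uniform_prob (@ltr01 R) [set t | (level beta t < k)%N]%classic = (cum beta k)%:E.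
Proof.
move=> b0; case: k => [_|j jM].
  rewrite (_ : mkset _ = set0)%classic; first by rewrite measure0.
  by apply/seteqP; split.
have [jM'|jM'] := boolP (j < M.+1)%N; last first.
  rewrite (_ : mkset _ = setT)%classic; last first.
    apply/seteqP; split=> // t _ /=; apply: leq_trans (ltn_ord _) _.
    by rewrite ltnS leqNgt.
  by split=> //; rewrite probability_setT /= -ltnS (negbTE jM').
rewrite (_ : mkset _ = `]-oo, h (Ordinal jM') beta]%classic); last first.
  by apply/seteqP; split => t /=; rewrite in_itv /= -level_le.
split=> //; rewrite uniform_prob_ray -?(cumS beta (Ordinal jM')) //.
by rewrite cumS; case/andP: (h_range (Ordinal jM') b0) => -> /ltW.
Qed.

Lemma level_law beta (k : 'I_M.+2) : 0 < beta ->
  measurable [set t | level beta t = k]%classic /\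
  uniform_prob (@ltr01 R) [set t | level beta t = k]%classic = (mlev beta k)%:E.
Proof.
move=> b0.
have [m1 p1] := level_lt_set b0 (ltn_ord k : (k.+1 <= M.+2)%N).
have [m0 p0] := level_lt_set b0 (ltnW (ltn_ord k)).
have -> : ([set t | level beta t = k] =
  [set t | (level beta t < k.+1)%N] `\` [set t | (level beta t < k)%N])%classic.
  apply/seteqP; split => t /=; first by move=> ->; rewrite ltnS leqnn ltnn.
  rewrite ltnS => -[tk /negP]; rewrite -leqNgt => kt; apply: val_inj => /=.
  by apply/eqP; rewrite eqn_leq tk kt.
split; first exact: measurableD.
pose mu : probability _ R := uniform_prob (@ltr01 R).
have fin : (mu [set t | (level beta t < k.+1)%N]%classic < +oo)%E.
  exact: le_lt_trans (probability_le1 mu m1) (ltry 1).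
etransitivity; first exact: (measureD (mu := mu) m1 m0 fin).
rewrite setIidr; last by move=> t /= /ltnW; rewrite ltnS.
exact: (congr2 (fun a b => a - b)%E p1 p0).
Qed.
End UniformLevels.

Local Open Scope classical_set_scope.

(** * Events determined by a variable with finitely many values *)

Section FinitePartition.
Variables (dT : measure_display) (T : measurableType dT) (R : realType).
Variables (mu : {measure set T -> \bar R}) (C : finType) (g : T -> C).
Hypothesis mg : forall c, measurable [set w | g w = c].

Lemma bigcup_finite_partition (Q : pred C) :
  [set w | Q (g w)] = \bigcup_(c in [set` Q]) [set w | g w = c].
Proof.
apply/seteqP; split => w /=; first by move=> Qw; exists (g w).
by move=> [c /= Qc ->].
Qed.

Lemma measurable_finite_partition (Q : pred C) : measurable [set w | Q (g w)].
Proof. by rewrite bigcup_finite_partition; apply: fin_bigcup_measurable. Qed.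

Lemma measure_finite_partition (Q : pred C) :
  mu [set w | Q (g w)] = (\sum_(c | Q c) mu [set w | g w = c])%E.
Proof.
rewrite bigcup_finite_partition measure_fin_bigcup //; last first.
  by move=> c c' _ _ [w /= [-> ->]].
by rewrite -(@bigfs _ _ _ _ (index_enum C) Q) ?index_enum_uniq // => c _; rewrite mem_index_enum.
Qed.
End FinitePartition.

(** * Law of the weights and levels on a finite subgraph *)

Section FiniteLaw.
Variables (R : realType) (d M N : nat).
Variables (h : 'I_M.+1 -> R -> R) (zeta : 'I_N.+1 -> 'I_N.+1 -> 'I_M.+1).
Hypothesis h_range : forall m beta, 0 < beta -> 0 <= h m beta < 1.
Hypothesis h_lt : forall (m m' : 'I_M.+1) beta, 0 < beta -> (m < m')%N ->
    h m beta < h m' beta.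
Variables (q_nu : probability 'I_N.+1 R) (dT : measure_display) (T : measurableType dT).
Variables (P : probability T R) (nu : 'rV[int]_d -> {RV P >-> 'I_N.+1}).
Variable (U : set 'rV[int]_d -> {RV P >-> measurableTypeR R}).
Hypothesis nu_iid : iid setT nu q_nu.
Hypothesis U_iid : iid edges U (uniform_prob (@ltr01 R)).
Hypothesis nu_U_indep : independent_systems P
    (generated_sigma_algebra setT nu) (generated_sigma_algebra edges U).
Variables (V : finType) (iota : V -> 'rV[int]_d) (iota_inj : injective iota).
Variables (beta : R) (beta_gt0 : 0 < beta).

Definition adj : rel V := fun x y => l1norm (iota x - iota y) == 1%N.

Definition is_edge (s : {set V}) := [exists x, exists y, adj x y && (s == [set x; y]%SET)].

Definition embed (s : {set V}) : set 'rV[int]_d := iota @` [set` s].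

Definition weight_cfg (w : T) : {ffun V -> 'I_N.+1} := [ffun x => nu (iota x) w].

Definition level_cfg (w : T) : {ffun {set V} -> 'I_M.+2} :=
  [ffun s => if is_edge s then level h beta (U (embed s) w) else ord_max].

Definition weight_law (k : 'I_N.+1) : R := fine (q_nu [set k]).

(* The coordinates that are not edges are frozen, so that the unused part of the
   finite configuration does not involve [U]. *)
Definition level_law_at (s : {set V}) (k : 'I_M.+2) : R :=
  if is_edge s then mlev h beta k else (k == ord_max)%:R.

Lemma embedE s x : embed s (iota x) <-> x \in s.
Proof. by split=> [[y ys /iota_inj <-]|xs]; [|exists x]. Qed.

Lemma embed_inj : injective embed.
Proof.
move=> s t E; apply/setP => x.
by apply/idP/idP => /embedE; rewrite -/(embed _); [rewrite E | rewrite -E] => /embedE.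
Qed.

Lemma embed_set2 x y : embed [set x; y]%SET = [set iota x; iota y].
Proof.
apply/seteqP; split=> z /=; first by case=> t /=; rewrite !inE => /orP[]/eqP-> <-; [left|right].
by case=> ->; apply/embedE; rewrite !inE eqxx ?orbT.
Qed.

(** Membership in the generated sigma-algebra is recorded along with the probability because the
    independence of the two families is stated on these sigma-algebras. *)
Lemma weight_event (v : {ffun V -> 'I_N.+1}) :
  generated_sigma_algebra setT nu [set w | weight_cfg w = v] /\
  P [set w | weight_cfg w = v] = (\prod_x weight_law (v x))%:E.
Proof.
pose F := [fset iota x | x in V]%fset.
(* The whole space away from the image of [iota], and the singleton of [v x] at [iota x]. *)
pose A (j : 'rV[int]_d) : set 'I_N.+1 := [set k | forall x, iota x = j -> k = v x].
have AE x : A (iota x) = [set v x].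
  apply/seteqP; split => k /=; first by apply.
  by move=> -> y /iota_inj ->.
have -> : [set w | weight_cfg w = v] = \bigcap_(j in [set` F]) (nu j @^-1` A j).
  apply/seteqP; split => w /=.
    by move=> cv _ /imfsetP[x _ ->] /= y /iota_inj ->; rewrite -cv ffunE.
  move=> H; apply/ffunP => x; rewrite ffunE.
  by apply: (H (iota x)) => //=; apply/imfsetP; exists x.
split.
  rewrite /generated_sigma_algebra.
  apply: (@fin_bigcap_measurable _ (g_sigma_algebraType _)).
    exact: finite_fset.
  move=> j _; apply: sub_sigma_algebra; exists j => //=.
  exists (A j) => //.
  by rewrite setTI.
rewrite (nu_iid.1 F A) //.
rewrite big_imfset /=; last by move=> x y _ _; exact: iota_inj.
rewrite -prodEFin big_enum /=; apply: eq_bigr => x _.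
have E : P (nu (iota x) @^-1` [set v x]) = q_nu [set v x] by exact: (nu_iid.2 (iota x) I).
by rewrite AE E fineK // fin_num_measure.
Qed.

Lemma level_event (u : {ffun {set V} -> 'I_M.+2}) :
  generated_sigma_algebra edges U [set w | level_cfg w = u] /\
  P [set w | level_cfg w = u] = (\prod_s level_law_at s (u s))%:E.
Proof.
(* A configuration with a value other than [ord_max] at a non-edge has probability 0 on both
   sides. *)
have [frozen|frozen] := boolP [forall s, ~~ is_edge s ==> (u s == ord_max)]; last first.
  have [s /andP[ns us]] : exists s, ~~ is_edge s && (u s != ord_max).
    by apply/existsP; move: frozen; rewrite negb_forall; apply: eq_ind;
      apply: eq_existsb => s; rewrite negb_imply.
  rewrite (_ : mkset _ = set0).
    split; first by apply: (@measurable0 _ (g_sigma_algebraType _)).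
    by rewrite measure0 (bigD1 s) //= /level_law_at (negbTE ns) (negbTE us) mul0r.
  apply/seteqP; split => w //= E; case/negP: us.
  by rewrite -E ffunE (negbTE ns).
pose F := [fset embed s | s in [set s | is_edge s]%SET]%fset.
pose A (j : set 'rV[int]_d) : set R :=
  if [pick s | is_edge s && (embed s == j)] is Some s
  then [set t | level h beta t = u s] else setT.
have mA j : measurable (A j).
  rewrite /A; case: pickP => // s _.
  by have [] := level_law h_range h_lt (u s) beta_gt0.
have AE s : is_edge s -> A (embed s) = [set t | level h beta t = u s].
  move=> es; rewrite /A; case: pickP => [t /andP[_ /eqP/embed_inj ->//]|/(_ s)].
  by rewrite es eqxx.
have FE j : j \in F -> exists2 s, is_edge s & j = embed s.
  by move=> /imfsetP[s /=]; rewrite inE => es ->; exists s.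
have Fedges j : j \in F -> edges j.
  move=> /FE[s /existsP[x /existsP[y /andP[xy /eqP->]]] ->].
  by exists (iota x), (iota y); split; [exact/eqP | exact: embed_set2].
have -> : [set w | level_cfg w = u] = \bigcap_(j in [set` F]) (U j @^-1` A j).
  apply/seteqP; split => w /=.
    by move=> cu j /= /FE[s es ->]; rewrite /= AE //= -cu ffunE es.
  move=> H; apply/ffunP => s; rewrite ffunE; case: ifPn => es.
    have : (U (embed s) @^-1` A (embed s)) w.
      by apply: H => /=; apply/imfsetP; exists s => //=; rewrite inE.
    by rewrite /= AE.
  by apply/esym/eqP; move/forallP: frozen => /(_ s)/implyP; apply.
split.
  apply: (@fin_bigcap_measurable _ (g_sigma_algebraType _)); first exact: finite_fset.
  move=> j jF; apply: sub_sigma_algebra; exists j; first exact: Fedges.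
  by exists (A j); [exact: mA | rewrite setTI].
rewrite (U_iid.1 F A) //.
rewrite big_imfset /=; last by move=> x y _ _; exact: embed_inj.
rewrite [in RHS](bigID is_edge) /= [X in (_ * X)%:E]big1 ?mulr1; last first.
  move=> s es; rewrite /level_law_at (negbTE es).
  by move/forallP: frozen => /(_ s)/implyP/(_ es) ->.
rewrite -prodEFin big_enum /=; apply: eq_big => s; first by rewrite inE.
rewrite inE => es; rewrite /level_law_at es AE //.
have [mL <-] := level_law h_range h_lt (u s) beta_gt0.
apply: (U_iid.2 (embed s) _ [set t | level h beta t = u s] mL).
by apply: Fedges; apply/imfsetP; exists s => //=; rewrite inE.
Qed.

Lemma weight_law_ge0 k : 0 <= weight_law k.
Proof. exact: fine_ge0. Qed.

Lemma sum_weight_law : \sum_k weight_law k = 1.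
Proof.
apply: EFin_inj; rewrite -sumEFin -(@probability_setT _ _ _ q_nu).
rewrite [RHS](_ : _ = q_nu [set k | predT k]).
  rewrite (@measure_finite_partition _ _ _ q_nu _ id) //=.
  by apply: eq_bigr => k _; rewrite fineK ?fin_num_measure.
by congr (q_nu _); apply/seteqP; split.
Qed.

Lemma level_law_at_ge0 s k : 0 <= level_law_at s k.
Proof. by rewrite /level_law_at; case: ifP => // _; exact: mlev_ge0. Qed.

Lemma sum_level_law_at s : \sum_k level_law_at s k = 1.
Proof.
rewrite /level_law_at; case: (is_edge s); first exact: (sum_mlev h beta).
by rewrite (bigD1 ord_max) //= eqxx big1 ?addr0 // => k /negbTE ->.
Qed.

Lemma generated_measurable (J : Type) (dS : measure_display) (S : measurableType dS)
  (I : set J) (X : J -> {RV P >-> S}) A : generated_sigma_algebra I X A -> measurable A.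
Proof.
apply: smallest_sub => [|B [j _ [C mC <-]]]; first exact: sigma_algebra_measurable.
by rewrite setTI; exact: measurable_funPTI.
Qed.

(** The bridge from the probability space to finite sums: on each atom of the finite configuration,
    independence of weights and levels splits the mass into the two products. *)
Lemma cfg_law (Q : {ffun V -> 'I_N.+1} -> {ffun {set V} -> 'I_M.+2} -> bool) :
  measurable [set w | Q (weight_cfg w) (level_cfg w)] /\
  P [set w | Q (weight_cfg w) (level_cfg w)] = (Pr2 weight_law level_law_at Q)%:E.
Proof.
pose g w := (weight_cfg w, level_cfg w).
have gE v u : [set w | g w = (v, u)] = [set w | weight_cfg w = v] `&` [set w | level_cfg w = u].
  by apply/seteqP; split => w /=; [case=> -> -> | case=> <- <-].
have mg c : measurable [set w | g w = c].
  case: c => v u; rewrite gE; apply: measurableI.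
    exact: (generated_measurable (weight_event v).1).
  exact: (generated_measurable (level_event u).1).
have Qg : [set w | Q (weight_cfg w) (level_cfg w)] =
    [set w | (fun c => Q c.1 c.2) (g w)] by [].
rewrite Qg; split; first exact: (measurable_finite_partition mg (fun c => Q c.1 c.2)).
rewrite (measure_finite_partition P mg (fun c => Q c.1 c.2)).
transitivity (\sum_(c | Q c.1 c.2) ((\prod_x weight_law (c.1 x)) *
    (\prod_s level_law_at s (c.2 s)))%:E)%E.
  apply: eq_bigr => -[v u] _; rewrite gE.
  etransitivity; first exact: (nu_U_indep (weight_event v).1 (level_event u).1).
  by rewrite (weight_event v).2 (level_event u).2 EFinM.
rewrite sumEFin; congr EFin; rewrite big_mkcond /=.
rewrite -(pair_bigA _ (fun v u => if Q v u then
  (\prod_x weight_law (v x)) * (\prod_s level_law_at s (u s)) else 0)) /=.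
rewrite /Pr2 /Ex2 /Ex; apply: eq_bigr => v _; rewrite mulr_sumr.
by apply: eq_bigr => u _; case: (Q v u); rewrite ?mulr1 ?mulr0.
Qed.
End FiniteLaw.

(** * Boxes of the lattice *)

Section Lattice.
Variable d : nat.
Implicit Types (a b c x y z : 'rV[int]_d).

Lemma linfnorm_le x n : (linfnorm x <= n)%N <-> forall i, (`|x ord0 i| <= n)%N.
Proof.
split=> [/bigmax_leqP H i|H]; first exact: H.
by apply/bigmax_leqP => i _; exact: H.
Qed.

Lemma linfnorm_triangle x y z : (linfnorm (x - z)%R <= linfnorm (x - y)%R + linfnorm (y - z)%R)%N.
Proof.
apply/linfnorm_le => i.
have Hx : (`|(x - y)%R ord0 i| <= linfnorm (x - y)%R)%N by move: (i); exact/linfnorm_le.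
have Hy : (`|(y - z)%R ord0 i| <= linfnorm (y - z)%R)%N by move: (i); exact/linfnorm_le.
apply: leq_trans (leq_add Hx Hy); rewrite !mxE.
move: (x ord0 i) (y ord0 i) (z ord0 i) => p q r; lia.
Qed.

Lemma linfnorm_sym x y : linfnorm (x - y)%R = linfnorm (y - x)%R.
Proof. by apply: eq_bigr => i _; rewrite !mxE distnC. Qed.

Lemma l1norm_sym x y : l1norm (x - y)%R = l1norm (y - x)%R.
Proof. by apply: eq_bigr => i _; rewrite !mxE distnC. Qed.

Lemma linfnorm_le_l1norm x : (linfnorm x <= l1norm x)%N.
Proof. by apply/linfnorm_le => i; rewrite /l1norm (bigD1 i) //= leq_addr. Qed.

Lemma linfnorm0 : linfnorm (0 : 'rV[int]_d) = 0%N.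
Proof. by apply/eqP; rewrite -leqn0; apply/linfnorm_le => i; rewrite mxE. Qed.

Definition restrict_rel (r : rel 'rV[int]_d) (A : set 'rV[int]_d) : rel 'rV[int]_d :=
  [rel a b | [&& a \in A, b \in A & r a b]].

Definition box c n : set 'rV[int]_d := [set x | (linfnorm (x - c)%R <= n)%N].

Lemma connected_sub (r r' : rel 'rV[int]_d) x y :
  (forall a b, r a b -> r' a b) -> connected_by r x y -> connected_by r' x y.
Proof. by move=> rr' [p pth py]; exists p => //; apply: sub_path pth. Qed.

(** A step changes the norm by at most 1, so the path cannot jump over the sphere of radius [n]; it
    is stopped at its first visit there. *)
Lemma first_hit (r : rel 'rV[int]_d) c n x z :
  (forall a b, r a b -> l1norm (a - b)%R = 1%N) ->
  (linfnorm (x - c)%R <= n <= linfnorm (z - c)%R)%N -> connected_by r x z ->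
  exists2 y, linfnorm (y - c)%R = n & connected_by (restrict_rel r (box c n)) x y.
Proof.
move=> step /andP[xn zn] [p]; elim: p x xn => [|y p IH] x xn /=.
  move=> _ xz; exists x; last by exists [::].
  by apply/eqP; rewrite eqn_leq xn xz.
move=> /andP[xy pth] pz.
have [/eqP xE|xN] := boolP (linfnorm (x - c)%R == n); first by exists x => //; exists [::].
have yn : (linfnorm (y - c)%R <= n)%N.
  have := linfnorm_triangle y x c; have := linfnorm_le_l1norm (y - x)%R.
  rewrite l1norm_sym (step _ _ xy); lia.
have [t tn [p' pth' p't]] := IH y yn pth pz; exists t => //; exists (y :: p') => //=.
by rewrite pth' /restrict_rel /= xy !andbT; apply/andP; split; rewrite inE.
Qed.

Definition cube n := {ffun 'I_d -> 'I_(n + n).+1}.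

(** Coordinates 0, ..., 2n are shifted by [n], so that one index type serves the boxes of radius [n]
    around all centres. *)
Definition cube_pt c n (f : cube n) : 'rV[int]_d := \row_i (c ord0 i + ((f i)%:Z - n%:Z)).

Arguments cube_pt : clear implicits.

Lemma cube_pt_inj c n : injective (cube_pt c n).
Proof.
move=> f g /rowP E; apply/ffunP => i; apply: val_inj.
by have := E i; rewrite !mxE => /addrI/addIr [].
Qed.

Lemma cube_ptB c n (f g : cube n) : cube_pt c n f - cube_pt c n g = cube_pt 0 n f - cube_pt 0 n g.
Proof. by apply/rowP => i; rewrite !mxE; ring. Qed.

Lemma cube_pt0 c n (f : cube n) : cube_pt c n f - c = cube_pt 0 n f.
Proof. by apply/rowP => i; rewrite !mxE; ring. Qed.

Lemma cube_pt_box c n (f : cube n) : box c n (cube_pt c n f).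
Proof. by apply/linfnorm_le => i; rewrite !mxE; move: (c ord0 i) (ltn_ord (f i)) => k; lia. Qed.

Lemma cube_pt_surj c n x : box c n x -> exists f, cube_pt c n f = x.
Proof.
move=> /linfnorm_le xn; exists [ffun i => inord (absz (x ord0 i - c ord0 i + n%:Z)%R)].
apply/rowP => i; have := xn i; rewrite !mxE ffunE.
by move: (x ord0 i) (c ord0 i) => k l ?; rewrite inordK; lia.
Qed.

Definition cube_mid n : cube n := [ffun => inord n].

Lemma cube_center c n : cube_pt c n (cube_mid n) = c.
Proof. by apply/rowP => i; rewrite !mxE ffunE inordK; move: (c ord0 i) => k; lia. Qed.

Definition cube_bd n : {set cube n} := [set f | linfnorm (cube_pt 0 n f) == n]%SET.

Lemma adj_cube_pt c n : adj (cube_pt c n) = adj (cube_pt 0 n).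
Proof. by apply/funext => f; apply/funext => g; rewrite /adj cube_ptB. Qed.

Lemma adj_sym (V : finType) (iota : V -> 'rV[int]_d) : symmetric (adj iota).
Proof. by move=> x y; rewrite /adj l1norm_sym. Qed.

(** Adjacent points differ by -1, 0 or 1 in each coordinate, which gives the crude bound 3^d on the
    degree. *)
Lemma adj_degree (V : finType) (iota : V -> 'rV[int]_d) (x : V) : injective iota ->
  (#|[pred y | adj iota x y]| <= 3 ^ d)%N.
Proof.
move=> inj; pose f (y : V) : {ffun 'I_d -> 'I_3} :=
  [ffun i => inord (absz (iota y ord0 i - iota x ord0 i + 1)%R)].
have -> : (3 ^ d = #|{ffun 'I_d -> 'I_3}|)%N by rewrite card_ffun !card_ord.
apply: (@leq_card_in _ _ f) => y z; rewrite !inE => xy xz /ffunP E.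
have le1 (t : V) i : adj iota x t -> (absz (iota t ord0 i - iota x ord0 i)%R <= 1)%N.
  move=> /eqP xt; rewrite -[leqRHS]xt l1norm_sym; apply: leq_trans (linfnorm_le_l1norm _).
  by have /linfnorm_le/(_ i) := leqnn (linfnorm (iota t - iota x)%R); rewrite !mxE.
apply: inj; apply/rowP => i.
have := congr1 val (E i); rewrite /= !ffunE; have := le1 _ i xy; have := le1 _ i xz.
by move: (iota x ord0 i) (iota y ord0 i) (iota z ord0 i) => k l t ? ?; rewrite !inordK; lia.
Qed.
End Lattice.
Arguments cube_pt {d} c n f.

(** * The dichotomy on the lattice *)

Section LatticePercolation.
Variables (R : realType) (d M N : nat).
Variables (h : 'I_M.+1 -> R -> R) (zeta : 'I_N.+1 -> 'I_N.+1 -> 'I_M.+1).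
Hypothesis h_range : forall m beta, 0 < beta -> 0 <= h m beta < 1.
Hypothesis zeta_sym : forall n1 n2, zeta n1 n2 = zeta n2 n1.
Hypothesis zeta_mono : forall n1 n2 n1' n2' : 'I_N.+1, (n1 <= n1')%N -> (n2 <= n2')%N ->
    (zeta n1 n2 <= zeta n1' n2')%N.
Hypothesis h_0 : forall beta, 0 < beta -> h ord0 beta = 0.
Hypothesis h_lt : forall (m m' : 'I_M.+1) beta, 0 < beta -> (m < m')%N ->
    h m beta < h m' beta.
Hypothesis h_incr : forall m : 'I_M.+1, (1 <= m)%N ->
    forall beta beta', 0 < beta -> beta < beta' -> h m beta < h m beta'.
Variables (q_nu : probability 'I_N.+1 R) (dT : measure_display) (T : measurableType dT).
Variables (P : probability T R) (nu : 'rV[int]_d -> {RV P >-> 'I_N.+1}).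
Variable (U : set 'rV[int]_d -> {RV P >-> measurableTypeR R}).
Hypothesis nu_iid : iid setT nu q_nu.
Hypothesis U_iid : iid edges U (uniform_prob (@ltr01 R)).
Hypothesis nu_U_indep : independent_systems P
    (generated_sigma_algebra setT nu) (generated_sigma_algebra edges U).

Notation open_at beta w := (open_edge h zeta nu U beta w).

Lemma open_step beta w a b : open_at beta w a b -> l1norm (a - b)%R = 1%N.
Proof. by case/andP=> /eqP. Qed.

Lemma open_mono beta beta' w a b : 0 < beta -> beta <= beta' ->
  open_at beta w a b -> open_at beta' w a b.
Proof.
move=> b0 bb' /andP[ab Uh]; rewrite /open_edge /= ab; apply: le_trans Uh _.
set m := zeta _ _; move: bb'; rewrite le_eqVlt => /orP[/eqP->//|bb'].
have [m0|m0] := posnP m; last exact/ltW/h_incr.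
have -> : m = ord0 by exact: val_inj.
by rewrite !h_0 // (lt_trans b0).
Qed.

(** * Events on a finite subgraph of the lattice *)

Section FiniteGraph.
Variables (V : finType) (iota : V -> 'rV[int]_d) (iota_inj : injective iota).
Variables (beta : R) (beta_gt0 : 0 < beta).

Notation fopn w := (opn (adj iota) zeta (weight_cfg nu iota w) (level_cfg h U iota beta w)).
Notation fconn w := (conn (adj iota) zeta (weight_cfg nu iota w) (level_cfg h U iota beta w)).
Notation fhit w := (hit (adj iota) zeta (weight_cfg nu iota w) (level_cfg h U iota beta w)).

Lemma opn_cfg w x y : fopn w x y = open_at beta w (iota x) (iota y).
Proof.
rewrite /opn /open_edge /= /adj; case xy : (_ == 1%N) => //=.
rewrite !ffunE (_ : is_edge iota [set x; y]%SET).
  by rewrite (level_le h_lt) // embed_set2.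
by apply/existsP; exists x; apply/existsP; exists y; rewrite /adj xy eqxx.
Qed.

Lemma mem_embed (A : {set V}) x : (iota x \in embed iota A) = (x \in A).
Proof. by apply/idP/idP; rewrite in_setE => /(embedE iota_inj). Qed.

Lemma conn_cfg w (A : {set V}) x y : fconn w A x y <->
  connected_by (restrict_rel (open_at beta w) (embed iota A)) (iota x) (iota y).
Proof.
split=> [/connectP[p pth ->]|[p]].
  exists (map iota p); last by rewrite last_map.
  rewrite path_map; apply: sub_path pth => a b /and3P[aA bA ab].
  by rewrite /restrict_rel /= !mem_embed aA bA -opn_cfg.
elim: p x => [|z p IH] x /=; first by move=> _ /iota_inj ->; exact: connect0.
move=> /andP[/and3P[xA zA xz] pth] py.
have : (embed iota A) z by rewrite -in_setE.
case=> t _ tz; subst z; apply: connect_trans (IH t pth py).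
by move: xA zA; rewrite !mem_embed => xA tA; apply: conn1; rewrite // opn_cfg.
Qed.

Lemma hit_cfg w (A D : {set V}) x : fhit w A D x <->
  exists2 y, y \in D &
    connected_by (restrict_rel (open_at beta w) (embed iota A)) (iota x) (iota y).
Proof.
split=> [/exists_inP[y yD /conn_cfg xy]|[y yD /conn_cfg xy]]; first by exists y.
by apply/exists_inP; exists y.
Qed.

Definition FPr (E : {ffun V -> 'I_N.+1} -> {ffun {set V} -> 'I_M.+2} -> bool) : R :=
  Pr2 (weight_law q_nu) (level_law_at h iota beta) E.

Lemma FPr_law (E : {ffun V -> 'I_N.+1} -> {ffun {set V} -> 'I_M.+2} -> bool) :
  measurable [set w | E (weight_cfg nu iota w) (level_cfg h U iota beta w)] /\
  P [set w | E (weight_cfg nu iota w) (level_cfg h U iota beta w)] = (FPr E)%:E.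
Proof. exact: (cfg_law h_range h_lt nu_iid U_iid nu_U_indep iota_inj beta_gt0 E). Qed.

Lemma conn_event (A : {set V}) x y :
  let E := [set w |
    connected_by (restrict_rel (open_at beta w) (embed iota A)) (iota x) (iota y)] in
  measurable E /\ P E = (FPr (fun v u => conn (adj iota) zeta v u A x y))%:E.
Proof.
move=> E; rewrite (_ : E = [set w | fconn w A x y]).
  exact: (FPr_law (fun v u => conn (adj iota) zeta v u A x y)).
by apply/seteqP; split => w /conn_cfg.
Qed.

Lemma hit_event (A D : {set V}) x :
  let E := [set w | exists2 y, y \in D &
    connected_by (restrict_rel (open_at beta w) (embed iota A)) (iota x) (iota y)] in
  measurable E /\ P E = (FPr (fun v u => hit (adj iota) zeta v u A D x))%:E.
Proof.
move=> E; rewrite (_ : E = [set w | fhit w A D x]).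
  exact: (FPr_law (fun v u => hit (adj iota) zeta v u A D x)).
by apply/seteqP; split => w /hit_cfg.
Qed.
End FiniteGraph.

Definition exit_event (c : 'rV[int]_d) n beta : set T :=
  [set w | exists2 y, linfnorm (y - c)%R = n & connected_by (open_at beta w) c y].

Definition theta_fin n beta : R :=
  FPr (cube_pt (0 : 'rV[int]_d) n) beta
    (fun v u => hit (adj (cube_pt 0 n)) zeta v u [set: cube d n]%SET (cube_bd d n) (cube_mid d n)).

Lemma embed_cube c n : embed (cube_pt c n) [set: cube d n]%SET = box c n.
Proof.
apply/seteqP; split => x /=; first by case=> f _ <-; exact: cube_pt_box.
by move=> /cube_pt_surj[f <-]; exists f => //=; rewrite inE.
Qed.

(** [first_hit] confines the path to the box around [c], and the finite law depends on positions
    only through adjacency, which does not see [c]: this is translation invariance. *)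
Lemma hit_cube_law c n beta : 0 < beta ->
  measurable (exit_event c n beta) /\ P (exit_event c n beta) = (theta_fin n beta)%:E.
Proof.
move=> b0.
have -> : theta_fin n beta = FPr (cube_pt c n) beta
    (fun v u => hit (adj (cube_pt c n)) zeta v u [set: cube d n]%SET (cube_bd d n) (cube_mid d n)).
  by rewrite /theta_fin /FPr /level_law_at /is_edge (adj_cube_pt c).
suff -> : exit_event c n beta = [set w | exists2 y, y \in cube_bd d n &
   connected_by (restrict_rel (open_at beta w) (embed (cube_pt c n) [set: cube d n]%SET))
     (cube_pt c n (cube_mid d n)) (cube_pt c n y)].
  exact: (hit_event (@cube_pt_inj _ c n) b0).
rewrite embed_cube cube_center; apply/seteqP; split=> w /=.
  case=> y yn /(first_hit (@open_step beta w) (c := c) (n := n)).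
  rewrite subrr linfnorm0 yn leqnn => /(_ isT)[z zn cz].
  have [|f fz] := @cube_pt_surj _ c n z; first by rewrite /box /= zn.
  by exists f; rewrite ?fz // inE -(cube_pt0 c) fz zn.
case=> f; rewrite inE -(cube_pt0 c) => /eqP fn cf; exists (cube_pt c n f) => //.
by apply: connected_sub cf => a b /and3P[].
Qed.

Lemma theta_n_fin n beta : 0 < beta ->
  theta_n h zeta nu U n beta = (theta_fin n beta)%:E.
Proof.
move=> b0; rewrite -(hit_cube_law 0 n b0).2 /theta_n; congr (P _).
by apply/seteqP; split => w [y yn cy]; exists y => //; rewrite ?subr0 // -yn subr0.
Qed.

Lemma P_le (A B : set T) : measurable A -> measurable B -> A `<=` B -> (P A <= P B)%E.
Proof. by move=> mA mB AB; apply: le_measure; rewrite ?inE. Qed.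

Lemma FPr_ge0 (V : finType) (iota : V -> 'rV[int]_d) beta E : 0 < beta -> 0 <= FPr iota beta E.
Proof.
move=> b0; exact: (Pr2_ge0 (weight_law_ge0 q_nu) (sum_weight_law q_nu)
  (level_law_at_ge0 h_range h_lt iota b0) (sum_level_law_at h iota beta)).
Qed.

Lemma theta_fin_ge0 n beta : 0 < beta -> 0 <= theta_fin n beta.
Proof. exact: FPr_ge0. Qed.

Lemma theta_fin_le1 n beta : 0 < beta -> theta_fin n beta <= 1.
Proof.
by move=> b0; have [m E] := hit_cube_law 0 n b0; rewrite -lee_fin -E probability_le1.
Qed.

Lemma theta_fin_noninc n n' beta : 0 < beta -> (n <= n')%N ->
  theta_fin n' beta <= theta_fin n beta.
Proof.
move=> b0 nn'; have [m E] := hit_cube_law 0 n b0; have [m' E'] := hit_cube_law 0 n' b0.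
rewrite -lee_fin -E -E'; apply: P_le => // w /= [y yn' cy].
have [|z zn cz] := first_hit (@open_step beta w) (c := 0) (n := n) _ cy.
  by rewrite subrr linfnorm0 /= yn'.
by exists z => //; apply: connected_sub cz => a b /and3P[].
Qed.

Lemma theta_fin_mono n beta beta' : 0 < beta -> beta <= beta' ->
  theta_fin n beta <= theta_fin n beta'.
Proof.
move=> b0 bb'; have b0' := lt_le_trans b0 bb'.
have [m E] := hit_cube_law 0 n b0; have [m' E'] := hit_cube_law 0 n b0'.
rewrite -lee_fin -E -E'; apply: P_le => // w /= [y yn cy]; exists y => //.
by apply: connected_sub cy => a b; exact: open_mono.
Qed.

(** * The functional [phi] and exponential decay *)

Implicit Type S : {fset 'rV[int]_d}.

Definition fset_bd S (a : 'rV[int]_d) : bool :=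
  `[< exists2 b, b \notin S & l1norm (a - b)%R = 1%N >].

Definition conn_in beta S (a : 'rV[int]_d) : set T :=
  [set w | connected_by (restrict_rel (open_at beta w) [set` S]) 0 a].

(* The finite-volume criterion of Duminil-Copin and Tassion, summed over the
   inner vertex boundary. *)
Definition phi beta S : R := \sum_(a <- S | fset_bd S a) fine (P (conn_in beta S a)).

Lemma embed_fset n (A : {set cube d n}) :
  embed (cube_pt 0 n) A = [set` [fset cube_pt 0 n f | f in A]%fset].
Proof.
apply/seteqP; split => x /=.
  by case=> f fA <-; apply/imfsetP; exists f.
by move=> /imfsetP[f fA ->]; exists f.
Qed.

Lemma cube_notbd n (f : cube d n) : f \notin cube_bd d n -> (linfnorm (cube_pt 0 n f) < n)%N.
Proof.
rewrite inE => fn; rewrite ltn_neqAle fn /=.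
by have := cube_pt_box 0 f; rewrite /box /= subr0.
Qed.

(** As [A] avoids the boundary of the cube, all its lattice neighbours lie in the cube, and the
    inner boundary is the same in the cube and in the lattice. *)
Lemma phi_cube n beta (A : {set cube d n}) : 0 < beta -> cube_mid d n \in A ->
  [disjoint A & cube_bd d n]%B ->
  phi beta [fset cube_pt 0 n f | f in A]%fset =
  \sum_(f in bd (adj (cube_pt 0 n)) A) FPr (cube_pt 0 n) beta
    (fun v u => conn (adj (cube_pt 0 n)) zeta v u A (cube_mid d n) f).
Proof.
move=> b0 oA AD; set S := imfset _ _ _.
have bdE f : f \in A -> fset_bd S (cube_pt 0 n f) = (f \in bd (adj (cube_pt 0 n)) A).
  move=> fA; rewrite inE fA /=; apply/asboolP/existsP.
    case=> b bS fb.
    have fn : (linfnorm (cube_pt 0 n f) < n)%N.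
      by apply: cube_notbd; rewrite (disjointFr AD).
    have [|g gb] := @cube_pt_surj _ 0 n b.
      have := linfnorm_triangle b (cube_pt 0 n f) 0.
      have := linfnorm_le_l1norm (cube_pt 0 n f - b); rewrite fb linfnorm_sym !subr0.
      by rewrite /box /= subr0; lia.
    exists g; rewrite /adj gb fb eqxx andbT; apply: contra bS => gA.
    by apply/imfsetP; exists g.
  case=> g /andP[gA /eqP fg]; exists (cube_pt 0 n g) => //.
  by apply: contra gA => /imfsetP[g' g'A /cube_pt_inj ->].
rewrite /phi big_mkcond big_imfset /=; last by move=> f g _ _; exact: cube_pt_inj.
rewrite big_enum /= -big_mkcondr /=; apply: eq_big => f.
  case fA: (f \in A) => /=; first exact: bdE.
  by rewrite inE fA.
move=> _; have [_ E] := conn_event (@cube_pt_inj _ 0 n) b0 A (cube_mid d n) f.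
rewrite -[RHS]/(fine _%:E) -E; congr (fine (P _)).
by rewrite embed_fset cube_center.
Qed.

(** A boundary vertex has at most 3^d outer neighbours; this threshold turns the factor of
    [exit_bound] into 1/2. *)
Definition kappa : R := (2 * (3 ^ d)%:R)^-1.

Lemma kappa_gt0 : 0 < kappa.
Proof. by rewrite invr_gt0 mulr_gt0 // ltr0n expn_gt0. Qed.

Lemma kappa_le1 : kappa <= 1.
Proof.
rewrite invf_le1; last by rewrite mulr_gt0 // ltr0n expn_gt0.
by rewrite -natrM ler1n muln_gt0 expn_gt0.
Qed.

Definition small_phi beta := exists2 S, 0 \in S & phi beta S < kappa.

Lemma fset_cube S m : (forall a, a \in S -> (linfnorm a < m)%N) ->
  exists2 A : {set cube d m}, S = [fset cube_pt 0 m f | f in A]%fset &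
    [disjoint A & cube_bd d m]%B.
Proof.
move=> Sm; exists [set f | cube_pt 0 m f \in S]%SET.
  apply/fsetP => a; apply/idP/imfsetP => [aS|[f]]; last by rewrite /= inE => fS ->.
  have [|f fa] := @cube_pt_surj _ 0 m a; first by rewrite /box /= subr0 ltnW // Sm.
  by exists f; rewrite ?fa //= inE fa.
apply/pred0P => f; apply/negP => /andP[/=]; rewrite !inE => /Sm fm /eqP E.
by rewrite E ltnn in fm.
Qed.

Lemma mid_in m (A : {set cube d m}) :
  (0 \in [fset cube_pt 0 m f | f in A]%fset) = (cube_mid d m \in A).
Proof.
rewrite -{1}(cube_center (0 : 'rV[int]_d) m); apply/imfsetP/idP => [[f fA]|].
  by move/cube_pt_inj ->.
by exists (cube_mid d m).
Qed.

(** All parameters share the same [nu] and [U], so the events are nested; placing [S] in a cube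
    makes them measurable. *)
Lemma phi_mono beta beta' S : 0 < beta -> beta <= beta' -> 0 \in S ->
  phi beta S <= phi beta' S.
Proof.
move=> b0 bb' S0; have b0' := lt_le_trans b0 bb'.
have [A SA AD] : exists2 A : {set cube d (\max_(a <- S) linfnorm a).+1},
    S = [fset cube_pt 0 _ f | f in A]%fset & [disjoint A & cube_bd d _]%B.
  by apply: fset_cube => a aS; rewrite ltnS; exact: leq_bigmax_seq.
have meas (a : 'rV[int]_d) b : 0 < b -> a \in S -> measurable (conn_in b S a).
  move=> bb aS; move: (aS); rewrite {1}SA => /imfsetP[f fA ->].
  have [mE _] := conn_event (@cube_pt_inj _ 0 _) bb A (cube_mid d _) f.
  by move: mE; rewrite embed_fset cube_center -SA.
rewrite /phi [leLHS]big_seq_cond [leRHS]big_seq_cond; apply: ler_sum => a /andP[aS _].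
rewrite fine_le //; [exact: fin_num_measure (meas _ _ _ _) |
  exact: fin_num_measure (meas _ _ _ _) |].
apply: P_le; [exact: meas | exact: meas |] => w; apply: connected_sub => x y.
by case/and3P=> xS yS xy; rewrite /restrict_rel /= xS yS; exact: open_mono xy.
Qed.

Lemma hit_le_theta n m beta (f : cube d m) : 0 < beta ->
  (n + linfnorm (cube_pt 0 m f) <= m)%N ->
  FPr (cube_pt 0 m) beta (fun v u => hit (adj (cube_pt 0 m)) zeta v u
    [set: cube d m]%SET (cube_bd d m) f) <= theta_fin n beta.
Proof.
move=> b0 nm.
have [mH EH] := hit_event (@cube_pt_inj _ 0 m) b0 [set: cube d m]%SET (cube_bd d m) f.
have [mE E] := hit_cube_law (cube_pt 0 m f) n b0.
rewrite -lee_fin -EH -E; apply: P_le => // w [g]; rewrite inE => /eqP gm cg.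
have cg' : connected_by (open_at beta w) (cube_pt 0 m f) (cube_pt 0 m g).
  by apply: connected_sub cg => a b /and3P[].
have [|z zn cz] := first_hit (@open_step beta w) (c := cube_pt 0 m f) (n := n) _ cg'.
  rewrite subrr linfnorm0 /=.
  have := linfnorm_triangle (cube_pt 0 m g) (cube_pt 0 m f) 0; rewrite !subr0 gm; lia.
by exists z => //; apply: connected_sub cz => a b /and3P[].
Qed.

Lemma theta_fin_half beta : 0 < beta -> small_phi beta ->
  exists2 L, (0 < L)%N & forall n, theta_fin (n + L) beta <= theta_fin n beta / 2.
Proof.
(* With this L, neighbours of [S] have norm at most L, so they are at distance at least [n] from the
   boundary of the box of radius n + L. *)
move=> b0 [S S0 Sk]; exists (\max_(a <- S) linfnorm a).+1 => // n.
set L := _.+1; set m := (n + L)%N.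
have SL a : a \in S -> (linfnorm a < L)%N by move=> aS; rewrite ltnS; exact: leq_bigmax_seq.
have [A SA AD] : exists2 A : {set cube d m}, S = [fset cube_pt 0 m f | f in A]%fset &
    [disjoint A & cube_bd d m]%B.
  by apply: fset_cube => a /SL aL; apply: leq_trans aL (leq_addl _ _).
have oA : cube_mid d m \in A by rewrite -mid_in -SA.
pose iota : cube d m -> 'rV[int]_d := cube_pt 0 m.
pose pconn f := FPr iota beta (fun v u => conn (adj iota) zeta v u A (cube_mid d m) f).
have pc0 f : 0 <= pconn f by exact: FPr_ge0.
have th0 := theta_fin_ge0 n b0.
apply: le_trans (exit_bound (adj iota) zeta_mono (weight_law_ge0 q_nu) (sum_weight_law q_nu)
  (level_law_at_ge0 h_range h_lt iota b0) (sum_level_law_at h iota beta) oA AD) _.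
apply: (@le_trans _ _ (\sum_(x in bd (adj iota) A) (3 ^ d)%:R * pconn x * theta_fin n beta)).
  rewrite [leRHS](_ : _ = \sum_(x in A) (if x \in bd (adj iota) A then
    (3 ^ d)%:R * pconn x * theta_fin n beta else 0)); last first.
    rewrite -big_mkcondr /=; apply: eq_bigl => x; rewrite andbC.
    by case xb: (x \in bd _ _) => //=; rewrite (bd_sub xb).
  apply: ler_sum => x xA; case: ifPn => xb; last first.
    rewrite big1 // => y /andP[yA xy]; case/negP: xb; rewrite inE xA /=.
    by apply/existsP; exists y; rewrite yA.
  apply: (@le_trans _ _ (\sum_(y | (y \notin A) && adj iota x y) pconn x * theta_fin n beta)).
    apply: ler_sum => y /andP[_ /eqP xy]; apply: ler_wpM2l; first exact: pc0.
    apply: hit_le_theta => //; rewrite -/iota /m leq_add2l.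
    have xL : (linfnorm (iota x) < L)%N by apply: SL; rewrite SA; apply/imfsetP; exists x.
    have := linfnorm_triangle (iota y) (iota x) 0.
    have := linfnorm_le_l1norm (iota x - iota y)%R; rewrite xy linfnorm_sym !subr0; lia.
  rewrite sumr_const -[leLHS]mulr_natl mulrA; apply: ler_wpM2r => //.
  apply: ler_wpM2r; first exact: pc0.
  rewrite ler_nat; apply: leq_trans (adj_degree x (@cube_pt_inj _ 0 m)).
  by apply: subset_leq_card; apply/fintype.subsetP => y; rewrite !inE => /andP[].
rewrite -mulr_suml -mulr_sumr -(phi_cube b0 oA AD) -SA.
have k0 : kappa * (2 * (3 ^ d)%:R) = 1.
  by rewrite mulVf // mulf_neq0 // pnatr_eq0 // expn_eq0.
rewrite mulrC; apply: ler_wpM2l => //.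
have d0 : 0 <= (3 ^ d)%:R :> R by rewrite ler0n.
have := ler_wpM2l d0 (ltW Sk); move: k0; move: (phi beta S) kappa ((3 ^ d)%:R : R) => p k D; lra.
Qed.

Lemma theta_fin_pow beta L : 0 < beta ->
  (forall n, theta_fin (n + L) beta <= theta_fin n beta / 2) ->
  forall k, theta_fin (k * L) beta <= 2^-1 ^+ k.
Proof.
move=> b0 half; elim=> [|k IH]; first by rewrite expr0 theta_fin_le1.
rewrite mulSn addnC; apply: le_trans (half _) _; rewrite exprSr.
by apply: ler_wpM2r => //; rewrite invr_ge0.
Qed.

Lemma theta_n_exp_decay beta : 0 < beta -> small_phi beta ->
  exists2 c : R, 0 < c & \forall n \near \oo,
    (theta_n h zeta nu U n beta <= (expR (- c * n%:R))%:E)%E.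
Proof.
move=> b0 /(theta_fin_half b0)[L L0 half].
have ln2 : 0 < ln (2 : R) by rewrite ln_gt0 // ltr1n.
have L0' : 0 < L%:R :> R by rewrite ltr0n.
(* For n >= L the integer quotient k of n by L satisfies n <= 2kL, so k halvings give 2^(-k) <=
   exp(- n ln 2 / (2L)). *)
exists (ln 2 / (2 * L%:R)); first by rewrite divr_gt0 // mulr_gt0.
near=> n; rewrite theta_n_fin // lee_fin.
set k := (n %/ L)%N.
have nL : (L <= n)%N by near: n; exact: nbhs_infty_ge.
have k1 : (1 <= k)%N by rewrite divn_gt0.
have kn : (k * L <= n)%N by rewrite leq_trunc_div.
have nk : (n <= 2 * k * L)%N.
  have : (n < k.+1 * L)%N by rewrite -ltn_divLR.
  have Lk : (L <= k * L)%N by rewrite leq_pmull.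
  by rewrite mulSn; lia.
apply: le_trans (theta_fin_noninc b0 kn) _; apply: le_trans (theta_fin_pow b0 half k) _.
have -> : (2^-1 : R) ^+ k = expR (- (ln 2 * k%:R)).
  by rewrite -mulNr -lnV ?posrE // expRM_natr lnK // posrE invr_gt0.
rewrite ler_expR mulNr lerN2 mulrAC -mulrA; apply: ler_wpM2l; first exact: ltW.
rewrite ler_pdivrMr ?mulr_gt0 //.
by rewrite -!natrM ler_nat mulnCA mulnA.
Unshelve. all: by end_near.
Qed.

(** * Connection to infinity *)

Lemma theta_bigcap beta :
  theta h zeta nu U beta = P (\bigcap_n exit_event 0 n beta).
Proof.
congr (P _); apply/seteqP; split => w /=.
  move=> H n _; have [y ny cy] := H n.
  have [|z zn cz] := first_hit (@open_step beta w) (c := 0) (n := n) _ cy.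
    by rewrite subrr linfnorm0 subr0.
  by exists z => //; apply: connected_sub cz => a b /and3P[].
move=> H n; have [y yn cy] := H n I; exists y => //.
by rewrite -yn subr0.
Qed.

Lemma measurable_bigcap_exit beta : 0 < beta -> measurable (\bigcap_n exit_event 0 n beta).
Proof. by move=> b0; apply: bigcapT_measurable => n; exact: (hit_cube_law 0 n b0).1. Qed.

Lemma theta_le_fin n beta : 0 < beta -> (theta h zeta nu U beta <= (theta_fin n beta)%:E)%E.
Proof.
move=> b0; have [mE <-] := hit_cube_law 0 n b0; rewrite theta_bigcap.
apply: P_le => //; first exact: measurable_bigcap_exit.
by move=> w; apply.
Qed.

Lemma theta_ge beta (t : R) : 0 < beta -> (forall n, t <= theta_fin n beta) ->
  (t%:E <= theta h zeta nu U beta)%E.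
Proof.
move=> b0 tle; rewrite theta_bigcap.
have cv : (P \o (fun n => exit_event 0 n beta)) @ \oo --> P (\bigcap_n exit_event 0 n beta).
  apply: nonincreasing_cvg_mu.
  - exact: le_lt_trans (probability_le1 P (hit_cube_law 0 0 b0).1) (ltry 1).
  - by move=> n; exact: (hit_cube_law 0 n b0).1.
  - exact: measurable_bigcap_exit.
  - move=> n n' nn'; apply/subsetPset => w /= [y yn' cy].
    have [|z zn cz] := first_hit (@open_step beta w) (c := 0) (n := n) _ cy.
      by rewrite subrr linfnorm0 /= yn'.
    by exists z => //; apply: connected_sub cz => a b /and3P[].
rewrite -(cvg_lim _ cv) //; apply: lime_ge.
  by apply/cvg_ex; exists (P (\bigcap_n exit_event 0 n beta)).
by apply: nearW => n /=; rewrite (hit_cube_law 0 n b0).2 lee_fin.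
Qed.

Lemma theta_small_phi beta : 0 < beta -> small_phi beta -> ~ (0 < theta h zeta nu U beta)%E.
Proof.
move=> b0 /(theta_fin_half b0)[L _ half] th0.
have thf : theta h zeta nu U beta \is a fin_num.
  by rewrite theta_bigcap fin_num_measure //; exact: measurable_bigcap_exit.
have [t tE] : exists t, theta h zeta nu U beta = t%:E.
  by exists (fine (theta h zeta nu U beta)); rewrite fineK.
have t0 : 0 < t by rewrite -lte_fin -tE.
have tk k : t <= 2^-1 ^+ k.
  apply: le_trans (theta_fin_pow b0 half k).
  by rewrite -lee_fin -tE; exact: theta_le_fin.
(* This exponent exceeds 1/t, hence so does the corresponding power of 2. *)
have := tk (Num.bound t^-1); rewrite exprVn leNgt => /negP; apply.
rewrite -[ltRHS]invrK ltf_pV2 ?posrE ?invr_gt0 ?exprn_gt0 //.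
apply: (@lt_le_trans _ _ (Num.bound t^-1)%:R).
  by apply: archi_boundP; rewrite invr_ge0 ltW.
by rewrite -natrX ler_nat ltnW // ltn_expl.
Qed.

(** If [zeta] vanished at the maximal weights, it would vanish everywhere by monotonicity. The first
    edge of a path from 0 would then need level 0, which has probability h_0 = 0, and a union bound
    over the edges of the cube of radius 1 would give [theta] = 0. *)
Lemma zeta_max_gt0 beta : 0 < beta -> (0 < theta h zeta nu U beta)%E ->
  (1 <= zeta ord_max ord_max)%N.
Proof.
move=> b0 th0; rewrite lt0n; apply/negP => /eqP z0.
have z0' a b : zeta a b = 0%N :> nat.
  apply/eqP; rewrite -leqn0 -[leqRHS]z0.
  by apply: zeta_mono; rewrite -ltnS ltn_ord.
pose iota := cube_pt (0 : 'rV[int]_d) 1.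
pose m := level_law_at h iota beta.
suff th1 : theta_fin 1 beta <= 0.
  by have := lt_le_trans th0 (theta_le_fin 1 b0); rewrite lte_fin ltNge th1.
apply: (@le_trans _ _ (Ex2 (weight_law q_nu) m
   (fun v u => \sum_(s | is_edge iota s) (u s == ord0)%:R))).
  apply: (Ex2_le (weight_law_ge0 q_nu) (level_law_at_ge0 h_range h_lt iota b0)) => v u.
  have [/exists_inP[y yD]|_] := boolP (hit _ _ _ _ _ _ _); last first.
    by apply: sumr_ge0 => s _; exact: ler0n.
  case/connectP=> -[_ oy|x p /= /andP[/and3P[_ _ /andP[ox us]] _] _].
    by move: yD; rewrite oy inE cube_center linfnorm0.
  apply: le_trans (ler_sum_term (j := [set cube_mid d 1; x]%SET) _ _) => //=.
    rewrite (_ : _ == _) //; rewrite -val_eqE /= -leqn0; apply: leq_trans us _.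
    by rewrite z0'.
  by apply/existsP; exists (cube_mid d 1); apply/existsP; exists x; rewrite ox eqxx.
rewrite (Ex2_sum (weight_law q_nu) m).
apply: sumr_le0 => s es; rewrite /Ex2.
under eq_Ex => v do rewrite (Ex_coord _ _ (sum_level_law_at h iota beta)).
rewrite Ex_cst; last by move=> _; exact: sum_weight_law.
rewrite /m /level_law_at es /mlev /= subr0 (_ : inord 0 = ord0) ?h_0 //.
by apply: val_inj; rewrite /= inordK.
Qed.

(** * Derivatives in [beta] and linear growth *)

Section Differentiation.
Hypothesis M_ge1 : (1 <= M)%N.
Hypothesis h_C1 : forall m : 'I_M.+1, (1 <= m)%N -> forall beta, 0 < beta ->
    derivable (h m) beta 1 /\ {for beta, continuous (derive1 (h m))}.
Hypothesis h_deriv : forall m m' : 'I_M.+1, m = m'.+1 :> nat -> forall beta, 0 < beta ->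
    derive1 (h m) beta >
    (1 - h m beta) / (1 - h m' beta) * derive1 (h m') beta.
Hypothesis q_nu_N : (0 < q_nu [set ord_max])%E.

Lemma is_derive_h0 (beta : R) : 0 < beta -> is_derive beta 1 (h ord0) 0.
Proof.
(* h_0 is prescribed for positive [beta] only, hence the comparison with 0 near [beta]. *)
move=> b0; apply: (near_eq_is_derive (f := cst 0)).
near=> b; rewrite h_0 //; near: b; exact: lt_nbhsr.
Unshelve. all: by end_near.
Qed.

Lemma is_derive_h m (beta : R) : 0 < beta -> is_derive beta 1 (h m) (derive1 (h m) beta).
Proof.
move=> b0; have [m0|m1] := posnP m.
  have -> : m = ord0 by exact: val_inj.
  have H := is_derive_h0 b0; rewrite derive1E derive_val; exact: H.
by rewrite derive1E; apply: derivableP; case: (h_C1 m1 b0).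
Qed.

Lemma dh0 (beta : R) : 0 < beta -> derive1 (h ord0) beta = 0.
Proof. by move=> b0; have H := is_derive_h0 b0; rewrite derive1E derive_val. Qed.

(** Induction on [m]: the ratio in [h_deriv] is nonnegative because h < 1, so h_m' exceeds a
    nonnegative multiple of h_(m-1)', starting from h_0' = 0. *)
Lemma dh_gt0 (m : 'I_M.+1) (beta : R) : 0 < beta -> (1 <= m)%N -> 0 < derive1 (h m) beta.
Proof.
move=> b0; case: m => m mM /=; elim: m mM => // m IH mM _.
have mM' : (m < M.+1)%N by exact: ltnW.
apply: le_lt_trans (h_deriv (m := Ordinal mM) (m' := Ordinal mM') erefl b0).
have h1 i : 0 < 1 - h i beta by rewrite subr_gt0; case/andP: (h_range i b0).
apply: mulr_ge0; first by apply: divr_ge0; exact: ltW.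
case: m => [|m] in mM mM' IH *; last exact/ltW/IH.
by rewrite (_ : Ordinal mM' = ord0) ?dh0 //; exact: val_inj.
Qed.

Definition dcum (beta : R) (k : nat) : R :=
  if k is j.+1 then (if (j <= M)%N then derive1 (h (inord j)) beta else 0) else 0.

Lemma is_derive_mlev (beta : R) (k : 'I_M.+2) : 0 < beta ->
  is_derive beta 1 (fun b => mlev h b k) (dcum beta k.+1 - dcum beta k).
Proof.
move=> b0; have H j : is_derive beta 1 (fun b => cum h b j) (dcum beta j).
  case: j => [|j] /=; first exact: is_derive_cst.
  by case: (j <= M)%N; [exact: is_derive_h | exact: is_derive_cst].
exact: (is_deriveB (H k.+1) (H k)).
Qed.

Definition dlevel (V : finType) (iota : V -> 'rV[int]_d) beta (s : {set V}) (k : 'I_M.+2) : R :=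
  if is_edge iota s then dcum beta k.+1 - dcum beta k else 0.

Lemma sum_dlevel_le (V : finType) (iota : V -> 'rV[int]_d) beta x y (j : 'I_M.+1) :
  adj iota x y ->
  \sum_(k : 'I_M.+2 | (k <= j)%N) dlevel iota beta [set x; y]%SET k = derive1 (h j) beta.
Proof.
move=> xy; rewrite /dlevel (_ : is_edge _ _); last first.
  by apply/existsP; exists x; apply/existsP; exists y; rewrite xy eqxx.
rewrite telescope_ord_le subr0 (minn_idPl _); last by rewrite ltnS ltnW.
by rewrite /= -ltnS ltn_ord inord_val.
Qed.

Lemma sum_dlevel (V : finType) (iota : V -> 'rV[int]_d) beta s :
  \sum_k dlevel iota beta s k = 0.
Proof.
rewrite /dlevel; case: (is_edge iota s); last by rewrite big1.
rewrite (eq_bigl (fun k : 'I_M.+2 => k <= M.+1)%N); last first.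
  by move=> k; rewrite -ltnS ltn_ord.
by rewrite telescope_ord_le minnn /= ltnn subr0.
Qed.

Definition dtheta_fin n beta : R :=
  let iota := cube_pt (0 : 'rV[int]_d) n in
  Ex2 (weight_law q_nu) (level_law_at h iota beta) (fun v u =>
    \sum_s influence (adj iota) zeta (cube_mid d n) (cube_bd d n) (dlevel iota beta) v u s).

(** The law of the weights does not depend on [beta], so Russo's formula is applied to the levels
    for each fixed weight configuration. *)
Lemma is_derive_theta_fin n (beta : R) : 0 < beta ->
  is_derive beta 1 (theta_fin n) (dtheta_fin n beta).
Proof.
move=> b0; pose iota := cube_pt (0 : 'rV[int]_d) n.
pose X v u : R := hitR (adj iota) zeta R (cube_mid d n) (cube_bd d n) v u.
apply: is_derive_eq.
  apply: (@is_derive_bigsum _ _ _ (fun (v : {ffun cube d n -> 'I_N.+1}) b =>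
    (\prod_i weight_law q_nu (v i)) * Ex (level_law_at h iota b) (X v))) => v.
  apply: (is_deriveM (is_derive_cst (\prod_i weight_law q_nu (v i)) _ _)).
  apply: (is_derive_Ex (dm := dlevel iota beta)); first exact: sum_level_law_at.
  move=> s k; rewrite /level_law_at /dlevel; case: (is_edge iota s).
    exact: is_derive_mlev.
  exact: is_derive_cst.
apply: eq_bigr => v _; rewrite /= scaler0 addr0 /GRing.scale /=; congr (_ * _).
by rewrite -Ex_sum.
Qed.

(** The costs of the surgery in terms of [h]: level 1 has probability h_1 - h_0 = h_1, and level M +
    1 has probability 1 - h_M, or 1 at a frozen coordinate. *)
Lemma theta_fin_differential n beta c : 0 < beta -> (1 <= zeta ord_max ord_max)%N ->
  ~ small_phi beta -> 0 <= c ->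
  (forall m : 'I_M.+1, (1 <= m)%N -> c <= derive1 (h m) beta) ->
  c * (weight_law q_nu ord_max ^+ 3 * h (inord 1) beta *
    (1 - h ord_max beta) ^+ (3 ^ d + 3 ^ d) * kappa) * (1 - theta_fin n beta) <=
  (3 ^ d)%:R * dtheta_fin n beta.
Proof.
move=> b0 zmax nphi c0 hc; pose iota := cube_pt (0 : 'rV[int]_d) n.
have inj : injective iota by exact: cube_pt_inj.
have hM := h_range ord_max b0; have h1 := h_range (inord 1) b0.
have h1_gt0 : 0 < h (inord 1) beta.
  by rewrite -(h_0 b0); apply: h_lt => //; rewrite inordK.
apply: (differential_inequality (e := adj iota)).
- exact: adj_sym.
- exact: zeta_sym.
- exact: zeta_mono.
- exact: weight_law_ge0.
- exact: sum_weight_law.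
- exact: level_law_at_ge0.
- exact: sum_level_law_at.
- by move=> x; exact: adj_degree.
- exact: zmax.
- by rewrite subr_gt0; case/andP: hM.
- by rewrite gerBl; case/andP: hM.
- exact: h1_gt0.
- by apply: ltW; case/andP: h1.
- move=> s; rewrite /level_law_at; case: (is_edge iota s); last first.
    by rewrite eqxx gerBl; case/andP: hM.
  rewrite /mlev /= ltnn leqnn (_ : inord M = ord_max) //.
  by apply: val_inj; rewrite /= inordK.
- move=> x y xy; rewrite /level_law_at (_ : is_edge _ _); last first.
    by apply/existsP; exists x; apply/existsP; exists y; rewrite xy eqxx.
  rewrite /mlev inordK //= M_ge1 (_ : inord 0 = ord0) ?h_0 ?subr0 //.
  by apply: val_inj; rewrite /= inordK.
- exact/ltW/kappa_gt0.
- exact: kappa_le1.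
- move=> A oA AD; rewrite leNgt; apply/negP => small; apply: nphi.
  exists [fset cube_pt 0 n f | f in A]%fset; first by rewrite mid_in.
  by rewrite phi_cube.
- exact: c0.
- move=> s k ns; rewrite /dlevel; case: ifP => // /existsP[x /existsP[y /andP[xy /eqP sE]]].
  by have := ns x y xy; rewrite sE eqxx.
- exact: sum_dlevel.
- move=> x y j xy; rewrite sum_dlevel_le //.
  have [j0|j1] := posnP j; last by apply: ltW; exact: dh_gt0.
  by rewrite (_ : j = ord0) ?dh0 //; exact: val_inj.
- by move=> x y j xy j1; rewrite sum_dlevel_le //; exact: hc.
- by rewrite expn_gt0.
Qed.

Lemma positive_lower_bound (J : finType) (Q : pred J) (f : J -> R) :
  (forall j, Q j -> 0 < f j) -> exists2 c : R, 0 < c & forall j, Q j -> c <= f j.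
Proof.
(* The reciprocal of 1 plus the sum of reciprocals is a positive lower bound even for an empty
   family. *)
move=> f0; pose s := 1 + \sum_(j | Q j) (f j)^-1.
have s0 : 0 <= \sum_(j | Q j) (f j)^-1.
  by apply: sumr_ge0 => j Qj; rewrite invr_ge0 ltW // f0.
have s_gt0 : 0 < s by rewrite ltr_pwDl.
exists s^-1; first by rewrite invr_gt0.
move=> j Qj; rewrite invf_ple ?posrE ?f0 //.
apply: le_trans (ler_sum_term (F := fun j => (f j)^-1) Qj _) _.
  by move=> i Qi; rewrite invr_ge0 ltW // f0.
by rewrite lerDr.
Qed.

Lemma dh_local_lower_bound (beta0 : R) : 0 < beta0 ->
  exists c delta : R, [/\ 0 < c, 0 < delta & forall beta, beta0 <= beta < beta0 + delta ->
    forall m : 'I_M.+1, (1 <= m)%N -> c <= derive1 (h m) beta].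
Proof.
move=> b0.
have [c c0 cle] := @positive_lower_bound _ (fun m : 'I_M.+1 => 1 <= m)%N
  (fun m => derive1 (h m) beta0) (fun m => dh_gt0 b0).
have : \forall b \near beta0, forall m : 'I_M.+1, (1 <= m)%N -> c / 2 <= derive1 (h m) b.
  apply: (@filter_forall R _ (fun (m : 'I_M.+1) b => (1 <= m)%N -> c / 2 <= derive1 (h m) b)
    (nbhs beta0) _) => m; have [m0|m1] := posnP m; first by near=> b.
  have cont := (h_C1 m1 b0).2.
  have : \forall b \near beta0, c / 2 < derive1 (h m) b.
    apply: (cvgr_gt (derive1 (h m) beta0) cont).
    by apply: lt_le_trans (cle m m1); rewrite ltr_pdivrMr // ltr_pMr // ltr1n.
  by apply: filterS => b /ltW.
move=> /nbhs_ballP[e /= e0 He]; exists (c / 2), e; split => //; first by rewrite divr_gt0.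
move=> b /andP[bb be]; apply: He; rewrite /ball /= ler0_norm ?subr_le0 // opprB.
by rewrite ltrBlDl.
Unshelve. all: by end_near.
Qed.

(** While [theta_fin] is at most 1/2, the differential inequality bounds its slope below by K / 2,
    uniformly in [n]; once it exceeds 1/2, the linear bound holds for trivial reasons on a short
    interval. *)
Lemma theta_fin_linear (beta0 : R) : 0 < beta0 -> (1 <= zeta ord_max ord_max)%N ->
  (forall beta, beta0 < beta -> ~ small_phi beta) ->
  exists c delta : R, [/\ 0 < c, 0 < delta & forall n beta, beta0 <= beta < beta0 + delta ->
    c * (beta - beta0) <= theta_fin n beta].
Proof.
move=> b0 zmax nphi; have [c [delta [c0 delta0 hc]]] := dh_local_lower_bound b0.
pose b1 := beta0 + delta.
have b10 : 0 < b1 by rewrite addr_gt0.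
have q0 : 0 < weight_law q_nu ord_max.
  by rewrite /weight_law fine_gt0 // q_nu_N -ge0_fin_numE // fin_num_measure.
have h1 : 0 < h (inord 1) beta0.
  by rewrite -(h_0 b0); apply: h_lt => //; rewrite inordK.
have hM : 0 < 1 - h ord_max b1 by rewrite subr_gt0; case/andP: (h_range ord_max b10).
(* h_1 is taken at the left end of the interval and h_M at the right end, where their contributions
   are smallest; K depends on neither [n] nor [beta]. *)
pose K := c * (weight_law q_nu ord_max ^+ 3 * h (inord 1) beta0 *
  (1 - h ord_max b1) ^+ (3 ^ d + 3 ^ d) * kappa) / (3 ^ d)%:R.
have D0 : 0 < (3 ^ d)%:R :> R by rewrite ltr0n expn_gt0.
have K0 : 0 < K.
  rewrite divr_gt0 // mulr_gt0 // mulr_gt0 ?kappa_gt0 // mulr_gt0 ?exprn_gt0 //.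
  by rewrite mulr_gt0 // exprn_gt0.
have dK n beta : beta0 < beta < b1 -> K * (1 - theta_fin n beta) <= dtheta_fin n beta.
  move=> /andP[bb bb1]; have bpos := lt_trans b0 bb.
  rewrite /K mulrAC ler_pdivrMr // [leRHS]mulrC.
  apply: le_trans (theta_fin_differential n bpos zmax (nphi _ bb) (ltW c0) _); last first.
    by move=> m m1; apply: hc => //; rewrite (ltW bb).
  apply: ler_wpM2r; first by rewrite subr_ge0 theta_fin_le1.
  apply: ler_wpM2l; first exact: ltW.
  apply: ler_wpM2r; first exact/ltW/kappa_gt0.
  have hle : h (inord 1) beta0 <= h (inord 1) beta by apply/ltW/h_incr => //; rewrite inordK.
  have hMle : 1 - h ord_max b1 <= 1 - h ord_max beta.
    by rewrite lerD2l lerN2; apply/ltW/h_incr.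
  apply: ler_pM; [|exact/exprn_ge0/ltW| |].
  - by rewrite mulr_ge0 ?exprn_ge0 // ltW.
  - by apply: ler_wpM2l => //; rewrite exprn_ge0 // ltW.
  - by apply: lerXn2r; rewrite ?nnegrE // ltW // (lt_le_trans hM).
(* Below K^-1 the bound K / 2 * (beta - beta0) is at most 1/2, which settles the case where
   [theta_fin] exceeds 1/2. *)
exists (K / 2), (Num.min delta K^-1); split; first by rewrite divr_gt0.
  by rewrite lt_min delta0 invr_gt0.
move=> n beta /andP[bb]; rewrite -ltrBlDl lt_min => /andP[bd bK].
have bpos := lt_le_trans b0 bb.
have [th12|th12] := leP (theta_fin n beta) (1 / 2); last first.
  apply: le_trans (ltW th12).
  rewrite mulrAC ler_pM2r ?invr_gt0 // -[leRHS](mulfV (lt0r_neq0 K0)).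
  by apply: ler_wpM2l; exact: ltW.
move: bb; rewrite le_eqVlt => /orP[/eqP <-|bb].
  by rewrite subrr mulr0 theta_fin_ge0.
have drv x : x \in `]beta0, beta[%R -> is_derive x 1 (theta_fin n) (dtheta_fin n x).
  by rewrite in_itv /= => /andP[x0 _]; apply: is_derive_theta_fin; exact: lt_trans x0.
have cont : {within `[beta0, beta]%classic, continuous (theta_fin n)}.
  apply: derivable_within_continuous => x; rewrite in_itv /= => /andP[x0 _].
  by have [] := is_derive_theta_fin n (lt_le_trans b0 x0).
have [x] := MVT bb drv cont; rewrite in_itv /= => /andP[x0 xb] E.
(* Monotonicity in the parameter carries the bound 1/2 from [beta] back to the intermediate
   point. *)
have thx : theta_fin n x <= 1 / 2.
  by apply: le_trans th12; apply: theta_fin_mono (ltW xb); exact: lt_trans x0.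
have := dK n x; rewrite x0 /= (lt_trans xb) => [/(_ isT)|]; last by rewrite /b1 -ltrBlDl.
move=> dKx; apply: (@le_trans _ _ (theta_fin n beta - theta_fin n beta0)); last first.
  by rewrite gerBl theta_fin_ge0.
rewrite E; apply: ler_wpM2r; first by rewrite subr_ge0 ltW.
apply: le_trans dKx; apply: ler_wpM2l; first exact: ltW.
by move: thx; lra.
Qed.
End Differentiation.
End LatticePercolation.

Local Open Scope ring_scope.

(** * Behaviour on the two sides of the critical point *)

Theorem theorem3p11 (R : realType) (d M N : nat)
  (d_ge2 : (2 <= d)%N) (M_ge1 : (1 <= M)%N) (N_ge1 : (1 <= N)%N)
  (h : 'I_M.+1 -> R -> R) (zeta : 'I_N.+1 -> 'I_N.+1 -> 'I_M.+1)
  (h_range : forall m beta, 0 < beta -> 0 <= h m beta < 1)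
  (zeta_sym : forall n1 n2, zeta n1 n2 = zeta n2 n1)
  (zeta_mono : forall n1 n2 n1' n2' : 'I_N.+1, (n1 <= n1')%N -> (n2 <= n2')%N ->
    (zeta n1 n2 <= zeta n1' n2')%N)
  (h_0 : forall beta, 0 < beta -> h ord0 beta = 0)
  (h_lt : forall (m m' : 'I_M.+1) beta, 0 < beta -> (m < m')%N ->
    h m beta < h m' beta)
  (h_incr : forall m : 'I_M.+1, (1 <= m)%N ->
    forall beta beta', 0 < beta -> beta < beta' -> h m beta < h m beta')
  (h_C1 : forall m : 'I_M.+1, (1 <= m)%N -> forall beta, 0 < beta ->
    derivable (h m) beta 1 /\ {for beta, continuous (derive1 (h m))})
  (h_deriv : forall m m' : 'I_M.+1, m = m'.+1 :> nat -> forall beta, 0 < beta ->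
    derive1 (h m) beta >
    (1 - h m beta) / (1 - h m' beta) * derive1 (h m') beta)
  (q_nu : probability 'I_N.+1 R) (q_nu_N : (0 < q_nu [set ord_max])%E)
  (dT : measure_display) (T : measurableType dT) (P : probability T R)
  (nu : 'rV[int]_d -> {RV P >-> 'I_N.+1})
  (U : set 'rV[int]_d -> {RV P >-> measurableTypeR R})
  (nu_iid : iid setT nu q_nu)
  (U_iid : iid edges U (uniform_prob (@ltr01 R)))
  (nu_U_indep : independent_systems P
    (generated_sigma_algebra setT nu) (generated_sigma_algebra edges U))
  (beta_c : R) (beta_c_gt0 : 0 < beta_c)
  (subcritical : forall beta, 0 < beta < beta_c -> theta h zeta nu U beta = 0%E)
  (supercritical : forall beta, beta_c < beta -> (0 < theta h zeta nu U beta)%E) :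
  (forall beta, 0 < beta < beta_c ->
    exists2 c : R, 0 < c &
      \forall n \near \oo,
        (theta_n h zeta nu U n beta <= (expR (- c * n%:R))%:E)%E) /\
  (exists c delta : R, [/\ 0 < c, 0 < delta &
    forall beta, beta_c <= beta < beta_c + delta ->
      ((c * (beta - beta_c))%:E <= theta h zeta nu U beta)%E]).
Proof.
have zmax : (1 <= zeta ord_max ord_max)%N.
  have b1 : 0 < beta_c + 1 by rewrite addr_gt0.
  apply: (zeta_max_gt0 h_range zeta_mono h_0 h_lt nu_iid U_iid nu_U_indep b1).
  by apply: supercritical; rewrite ltrDl.
(* Stated for any starting point: part (b) takes [beta_c], and part (a) takes a subcritical value
   and derives a contradiction. *)
have linear (beta0 : R) : 0 < beta0 ->
    (forall beta, beta0 < beta -> ~ small_phi h zeta nu U beta) ->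
    exists c delta : R, [/\ 0 < c, 0 < delta &
      forall beta, beta0 <= beta < beta0 + delta ->
        ((c * (beta - beta0))%:E <= theta h zeta nu U beta)%E].
  move=> b0 nphi; have [c [delta [c0 d0 H]]] := theta_fin_linear h_range zeta_sym zeta_mono
    h_0 h_lt h_incr nu_iid U_iid nu_U_indep M_ge1 h_C1 h_deriv q_nu_N b0 zmax nphi.
  exists c, delta; split=> // beta bb.
  apply: (theta_ge h_range h_lt nu_iid U_iid nu_U_indep); last by move=> n; exact: H.
  by case/andP: bb => /(lt_le_trans b0).
split=> [beta /andP[b0 bc]|]; last first.
  apply: linear => // beta bb.
  move=> /(theta_small_phi h_range zeta_mono h_lt nu_iid U_iid nu_U_indep (lt_trans beta_c_gt0 bb)).
  by apply; exact: supercritical.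
apply: (theta_n_exp_decay h_range zeta_mono h_lt nu_iid U_iid nu_U_indep b0).
apply: contrapT => nphi.
have [|c [delta [c0 d0 H]]] := linear beta b0.
  move=> beta' bb' [S S0 Sk]; apply: nphi; exists S => //; apply: le_lt_trans Sk.
  exact: (phi_mono zeta h_range h_0 h_lt h_incr nu_iid U_iid nu_U_indep b0 (ltW bb') S0).
(* Half the minimum keeps [beta + eps] strictly below both [beta + delta] and [beta_c], where
   [theta] vanishes although the linear bound is positive. *)
pose eps := Num.min delta (beta_c - beta) / 2.
have min0 : 0 < Num.min delta (beta_c - beta) by rewrite lt_min d0 subr_gt0.
have eps0 : 0 < eps by rewrite divr_gt0.
have : eps < Num.min delta (beta_c - beta) by rewrite ltr_pdivrMr // ltr_pMr // ltr1n.
rewrite lt_min => /andP[epsd epsc].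
have := H (beta + eps); rewrite lerDl (ltW eps0) ltrD2l epsd => /(_ isT).
rewrite subcritical ?addr_gt0 //=; last by rewrite addrC -ltrBrDr.
by rewrite addrAC subrr add0r lee_fin leNgt mulr_gt0.
Qed.
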